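(* Let $z\in\mathcal D(\mathcal K_\alpha^* )\subset L^2(0,T;\mathcal O)$ and let $r$ be a function that satisfies $$\begin{cases}{}^{RL}\mathcal D_{T^-}^{\alpha}r(y,s)=A^*r(y,s)+C^*z(s),&(y,s)\in Q_T,\ \alpha\in(0,1],\\ r(\xi,s)=0,&(\xi,s)\in\Sigma_T,\\ \lim_{s\to T^-}\mathcal I_{T^-}^{1-\alpha}r(y,s)=0,&y\in\Omega.\end{cases}$$ Then $\mathcal K_\alpha^*z=\mathcal I_{T^-}^{1-\alpha}r(\cdot,0)$.
   Context: Let $\Omega\subset\mathbb R^n$ ($n\ge1$) be open, bounded and connected with Lipschitz boundary, $T>0$, $Q_T=\Omega\times[0,T]$, $\Sigma_T=\partial\Omega\times[0,T]$, $E=L^2(\Omega)$. The operator $A$ on $E$ has domain $\mathcal D(A)=H^2(\Omega)\cap H^1_0(\Omega)$ and $Ay=\sum_{k,l=1}^n\partial_{x_k}(a_{k,l}\,\partial_{x_l}y)$, with $a_{k,l}\in C^1(\overline\Omega)$, $a_{k,l}=a_{l,k}$, and there is $\mu>0$ with $\sum_{k,l}a_{k,l}(x)\varsigma_k\varsigma_l\ge\mu\|\varsigma\|^2$ for all $x\in\Omega$, $\varsigma\in\mathbb R^n$. The eigenvalues of $-A$ are $0<\lambda_1<\lambda_2<\cdots\to+\infty$; $\lambda_i$ has finite multiplicity $r_i$ with eigenfunctions $\varphi_{i,j}\in\mathcal D(A)$, $-A\varphi_{i,j}=\lambda_i\varphi_{i,j}$, $1\le j\le r_i$, and $\{\varphi_{i,j}\}$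 is an orthonormal basis of $E$. Define $\mathcal S_\alpha(t)v=\sum_{i\ge1}E_\alpha(-\lambda_it^\alpha)\sum_{j=1}^{r_i}\langle v,\varphi_{i,j}\rangle\varphi_{i,j}$ with $E_\alpha(z)=\sum_{k\ge0}z^k/\Gamma(\alpha k+1)$. The observation operator $C:E\to\mathcal O$ (linear, possibly unbounded; $\mathcal O$ a Hilbert space) satisfies the admissibility condition: there is $M>0$ with $\int_0^T\|C\mathcal S_\alpha(t)v\|_{\mathcal O}^2dt\le M\|v\|_E^2$ for all $v\in\mathcal D(A)$. The observability operator is $\mathcal K_\alpha:\mathcal D(\mathcal K_\alpha)\subset E\to L^2(0,T;\mathcal O)$, $(\mathcal K_\alpha u_0)(t)=C\mathcal S_\alpha(t)u_0$, with adjoint $\mathcal K_\alpha^*z=\int_0^T\mathcal S_\alpha^*(e)C^*z(e)\,de$. The right-sided Riemann–Liouville fractional integral and derivative are $\mathcal I_{T^-}^{\alpha}r(y,s)=\frac1{\Gamma(\alpha)}\int_s^T(e-s)^{\alpha-1}r(y,e)\,de$ (with $\mathcal I_{T^-}^0$ the identity) and ${}^{RL}\mathcal D_{T^-}^{\alpha}r(y,s)=-\partial_s\int_s^T\frac{(e-s)^{-\alpha}}{\Gamma(1-\alpha)}r(y,e)\,de=-\partial_s\mathcal I_{T^-}^{1-\alpha}r(y,s)$.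
   Formalization: r is taken as a strong L²(Ω)-valued solution: r in L¹(0,T;E), I^{1-α}r locally absolutely continuous on (0,T) and continuous at 0, equation for a.e. s with C*z(s) in E, terminal limit in L²(Ω) norm; with the terminal limit only pointwise in y the claim fails. *)

(* Defs.v *)
From HB Require Import structures.
From mathcomp Require Import all_boot all_order all_algebra.
From mathcomp Require Import all_classical all_reals all_analysis.
Set Implicit Arguments.
Unset Strict Implicit.
Unset Printing Implicit Defensive.
Import Order.TTheory GRing.Theory Num.Theory.
Import numFieldNormedType.Exports.
Local Open Scope classical_set_scope.
Local Open Scope ring_scope.

Section row_vector_measurable.
Context (R : realType).

Definition rV_coord (n : nat) (i : 'I_n) (x : 'rV[R]_n) : R := x ord0 i.

(* The Borel sigma-algebra of R^n, generated by the coordinates. *)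
HB.instance Definition _ (n : nat) :=
  @isMeasurable.Build default_measure_display 'rV[R]_n
    (g_sigma_preimage (@rV_coord n))
    (@sigma_algebra0 _ _ _) (@sigma_algebraC _ _) (@sigma_algebra_bigcup _ _ _).

Lemma measurable_rV_coord (n : nat) (i : 'I_n) :
  measurable_fun [set: 'rV[R]_n] (@rV_coord n i).
Proof.
move=> _ Y mY; rewrite setTI; apply: sub_sigma_algebra => /=.
by rewrite -bigcup_seq/=; exists i => /=;
  [rewrite mem_index_enum|exists Y => //; rewrite setTI].
Qed.

Lemma measurable_fun_rV d (T : measurableType d) (n : nat) (f : T -> 'rV[R]_n) :
  (forall i, measurable_fun [set: T] (fun t => rV_coord i (f t))) ->
  measurable_fun [set: T] f.
Proof.
move=> mcoord _ Y mY; rewrite setTI.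
have : <<s preimage_set_system [set: T] f
    (\big[setU/set0]_(i < n)
      preimage_set_system setT (@rV_coord n i) measurable) >> (f @^-1` Y).
  by rewrite g_sigma_preimageE; exists Y => //; rewrite setTI.
apply: smallest_sub => /=; first exact: sigma_algebra_measurable.
move=> _ [B + <-]; rewrite -bigcup_seq/= => -[i _ [A mA <-]].
by rewrite !setTI -comp_preimage -[X in measurable X]setTI; exact: mcoord.
Qed.

Definition rV_cons (n : nat) (p : measurableTypeR R * 'rV[R]_n) : 'rV[R]_n.+1 :=
  \row_i oapp (p.2 ord0) p.1 (unlift ord0 i).

Definition rV_uncons (n : nat) (x : 'rV[R]_n.+1) : measurableTypeR R * 'rV[R]_n :=
  (x ord0 ord0, \row_j x ord0 (lift ord0 j)).

Lemma rV_consK (n : nat) : cancel (@rV_cons n) (@rV_uncons n).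
Proof.
case=> a v; rewrite /rV_uncons /rV_cons mxE unlift_none/=; congr pair.
by apply/rowP => j; rewrite !mxE liftK.
Qed.

Lemma measurable_rV_cons (n : nat) :
  measurable_fun [set: measurableTypeR R * 'rV[R]_n] (@rV_cons n).
Proof.
apply: measurable_fun_rV => i; rewrite /rV_coord/=.
under eq_fun do rewrite mxE.
case: (unliftP ord0 i) => [j _|_] /=; last exact: measurable_fst.
exact: (measurableT_comp (measurable_rV_coord j) measurable_snd).
Qed.

Lemma measurable_rV_uncons (n : nat) :
  measurable_fun [set: 'rV[R]_n.+1] (@rV_uncons n).
Proof.
apply: measurable_fun_pair; first exact: measurable_rV_coord.
apply: measurable_fun_rV => i; rewrite /rV_coord/=.
by under eq_fun do rewrite mxE; exact: measurable_rV_coord.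
Qed.

HB.instance Definition _ (n : nat) :=
  @isMeasurableFun.Build _ _ _ _ (@rV_cons n) (@measurable_rV_cons n).

End row_vector_measurable.

Section lebesgue_rV_step.
Context (R : realType) (n : nat)
  (mu : {sigma_finite_measure set 'rV[R]_n -> \bar R}).

Definition lebesgue_rV_step : set 'rV[R]_n.+1 -> \bar R :=
  pushforward (@lebesgue_measure R \x mu)%E (@rV_cons R n).

Let m : {measure set _ -> \bar R} := (@lebesgue_measure R \x mu)%E.

Let lebesgue_rV_step0 : lebesgue_rV_step set0 = 0%E.
Proof. by rewrite /lebesgue_rV_step /pushforward preimage_set0 measure0. Qed.

Let lebesgue_rV_step_ge0 A : (0 <= lebesgue_rV_step A)%E.
Proof. exact: (measure_ge0 m). Qed.

Let lebesgue_rV_step_sigma_additive : semi_sigma_additive lebesgue_rV_step.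
Proof.
exact: (@measure_semi_sigma_additive _ _ _
  (measure_function_pushforward__canonical__measure_function_Measure
    m (@measurable_rV_cons R n))).
Qed.

HB.instance Definition _ := isMeasure.Build _ _ _ lebesgue_rV_step
  lebesgue_rV_step0 lebesgue_rV_step_ge0 lebesgue_rV_step_sigma_additive.

Let lebesgue_rV_step_sigma_finite : sigma_finite setT lebesgue_rV_step.
Proof.
have /sigma_finiteP[F [TF ndF Foo]] := sigma_finiteT (@lebesgue_measure R).
have /sigma_finiteP[G [TG ndG Goo]] := sigma_finiteT mu.
pose H k := F k `*` G k.
have mH k : measurable (H k) by apply: measurableX; [case: (Foo k)|case: (Goo k)].
exists (fun k => @rV_uncons R n @^-1` H k).
  rewrite -preimage_bigcup (_ : \bigcup_k H k = setT) ?preimage_setT//.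
  rewrite -subTset => -[x y] _.
  have [i _ Fx] : (\bigcup_k F k) x by rewrite -TF.
  have [j _ Gy] : (\bigcup_k G k) y by rewrite -TG.
  exists (maxn i j) => //; split.
    by move: x Fx; exact/subsetPset/ndF/leq_maxl.
  by move: y Gy; exact/subsetPset/ndG/leq_maxr.
move=> k; split.
  by rewrite -[X in measurable X]setTI; exact: measurable_rV_uncons.
rewrite /lebesgue_rV_step /pushforward -comp_preimage.
rewrite (_ : _ \o _ = id); last by apply/funext => p; exact: rV_consK.
rewrite preimage_id product_measure1E; [|by case: (Foo k)|by case: (Goo k)].
have [mF Fk] := Foo k; have [mG Gk] := Goo k.
by rewrite lte_mul_pinfty// ge0_fin_numE.
Qed.

HB.instance Definition _ := @Measure_isSigmaFinite.Build _ _ _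
  lebesgue_rV_step lebesgue_rV_step_sigma_finite.

End lebesgue_rV_step.

Fixpoint lebesgue_rV (R : realType) (n : nat) :
    {sigma_finite_measure set 'rV[R]_n -> \bar R} :=
  if n is m.+1 then lebesgue_rV_step (lebesgue_rV R m)
  else @dirac _ 'rV[R]_0 (0 : 'rV[R]_0) R.

Lemma lebesgue_rV_box (R : realType) (n : nat) (a b : 'I_n -> R) :
  (forall i, a i <= b i) ->
  lebesgue_rV R n [set x | forall i, x ord0 i \in `]a i, b i]] =
  (\prod_(i < n) (b i - a i))%:E.
Proof.
elim: n => [|n IHn] in a b * => ab.
  rewrite big_ord0 /= diracE mem_set//= => -[].
  by [].
pose B := [set x : 'rV[R]_n.+1 | forall i, x ord0 i \in `]a i, b i]].
rewrite -/B -[LHS]/((@lebesgue_measure R \x lebesgue_rV R n)%E (@rV_cons R n @^-1` B)).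
pose B' := [set x : 'rV[R]_n | forall i, x ord0 i \in
  `]a (lift ord0 i), b (lift ord0 i)]].
have -> : @rV_cons R n @^-1` B = `]a ord0, b ord0]%classic `*` B'.
  apply/seteqP; split => [[x v]/= Bx|[x v]/= [/= Bx Bv] i].
    split => /=.
      by have := Bx ord0; rewrite /rV_cons mxE unlift_none.
    by move=> i; have := Bx (lift ord0 i); rewrite /rV_cons mxE liftK.
  rewrite /rV_cons mxE; case: (unliftP ord0 i) => [j ->|->] //=.
have mB' : measurable B'.
  rewrite (_ : B' = \bigcap_(i : 'I_n) (@rV_coord R n i @^-1`
     `]a (lift ord0 i), b (lift ord0 i)]%classic)).
    apply: fin_bigcap_measurable => [|i _]; first exact: finite_finset.
    by rewrite -[X in measurable X]setTI; exact: measurable_rV_coord.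
  by apply/seteqP; split => [x Bx i _|x Bx i]; [exact: Bx|exact: (Bx i I)].
rewrite product_measure1E//= lebesgue_measure_itv/= lte_fin IHn//.
rewrite big_ord_recl EFinM; case: ifPn => //.
rewrite -leNgt => ba; have -> : b ord0 = a ord0 by apply/le_anti; rewrite ba ab.
by rewrite subrr.
Qed.

(* Elements of a function space are represented by everywhere defined
   measurable functions, two of them being the same element when they agree
   almost everywhere; operators are represented by their graphs. *)

Section adjoint.
Context (R : realType) (U V : Type).

Definition adjoint (inU : set U) (dotU : U -> U -> R) (inV : set V)
    (dotV : V -> V -> R) (G : U -> V -> Prop) : V -> U -> Prop :=
  fun v u => [/\ inV v, inU u &
    forall u' v', G u' v' -> dotV v' v = dotU u' u].

End adjoint.

Section L2_Omega.
Context (R : realType) (n : nat) (Omega : set 'rV[R]_n).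
Implicit Types u v : 'rV[R]_n -> R.

Definition L2 : set ('rV[R]_n -> R) :=
  [set u : 'rV[R]_n -> R | measurable_fun Omega u /\
    (\int[lebesgue_rV R n]_(x in Omega) ((u x) ^+ 2)%:E < +oo)%E].

Definition dotL2 u v : R :=
  (\int[lebesgue_rV R n]_(x in Omega) (u x * v x))%R.

Definition normL2 u : R := Num.sqrt (dotL2 u u).

Definition eqL2 u v : Prop := ae_eq (lebesgue_rV R n) Omega u v.

End L2_Omega.

Section Lipschitz_domain.
Context (R : realType) (n : nat).

(* Up to an isometry y |-> y *m Q, Omega lies, near each point of its
   boundary, strictly on one side of the graph of a Lipschitz function of the
   first n coordinates. *)
Definition lipschitz_boundary (Omega : set 'rV[R]_n.+1) : Prop :=
  forall x, (closure Omega `\` Omega) x ->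
  exists (Q : 'M[R]_n.+1) (gamma : 'rV[R]_n -> R) (L e : R),
    [/\ Q *m Q^T = 1%:M, 0 < e,
        forall u v, `|gamma u - gamma v| <= L * `|u - v| &
        forall y, `|y - x| < e ->
          (Omega y <->
           gamma (col' ord_max (y *m Q)) < (y *m Q) ord0 ord_max)].

End Lipschitz_domain.

Section Sobolev.
Context (R : realType) (n : nat) (Omega : set 'rV[R]_n).
Implicit Types (u v g psi : 'rV[R]_n -> R) (k l : 'I_n).

Definition basis_rV k : 'rV[R]_n := delta_mx ord0 k.

Fixpoint C_class (m : nat) (f : 'rV[R]_n -> R) : Prop :=
  continuous f /\
  if m is m'.+1 then
    forall k, (forall x, derivable f x (basis_rV k)) /\
              C_class m' ('D_(basis_rV k) f)
  else True.

Definition test_function psi : Prop :=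
  (forall m, C_class m psi) /\
  exists K, [/\ compact K, K `<=` Omega & forall x, ~ K x -> psi x = 0].

Definition weak_partial k u g : Prop :=
  forall psi, test_function psi ->
    dotL2 Omega u ('D_(basis_rV k) psi) = - dotL2 Omega g psi.

Definition H1 u : Prop :=
  L2 Omega u /\ forall k, exists2 g, L2 Omega g & weak_partial k u g.

Definition H2 u : Prop :=
  L2 Omega u /\ forall k, exists2 g, H1 g & weak_partial k u g.

(* The closure of the test functions in H^1. *)
Definition H10 u : Prop :=
  H1 u /\ exists psi : nat -> 'rV[R]_n -> R,
    [/\ forall m, test_function (psi m),
        normL2 Omega (psi m \- u) @[m --> \oo] --> (0 : R) &
        forall k g, L2 Omega g -> weak_partial k u g ->
          normL2 Omega ('D_(basis_rV k) (psi m) \- g) @[m --> \oo] -->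
            (0 : R)].

(* C^1 up to the boundary: the function and its partial derivatives in Omega
   extend continuously to the closure. *)
Definition C1_closure (f : 'rV[R]_n -> R) : Prop :=
  {within closure Omega, continuous f} /\
  exists df : 'I_n -> 'rV[R]_n -> R, forall k,
    {within closure Omega, continuous (df k)} /\
    forall x, Omega x -> is_derive x (basis_rV k) f (df k x).

Definition elliptic_coefficients (a : 'I_n -> 'I_n -> 'rV[R]_n -> R) : Prop :=
  [/\ forall k l, C1_closure (a k l),
      forall k l x, closure Omega x -> a k l x = a l k x &
      exists2 mu : R, 0 < mu & forall x (s : 'rV[R]_n), Omega x ->
        mu * (\sum_k s ord0 k ^+ 2) <=
        \sum_k \sum_l a k l x * s ord0 k * s ord0 l].

Definition domA u : Prop := H2 u /\ H10 u.

(* Graph of A u = sum_(k, l) d_k (a_(k, l) d_l u) on H^2 and H^1_0; the g l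
   are the weak derivatives d_l u and the h k l those of the a_(k, l) d_l u. *)
Definition opA (a : 'I_n -> 'I_n -> 'rV[R]_n -> R) u v : Prop :=
  [/\ domA u, L2 Omega v &
      exists (g : 'I_n -> 'rV[R]_n -> R) (h : 'I_n -> 'I_n -> 'rV[R]_n -> R),
        [/\ forall l, L2 Omega (g l) /\ weak_partial l u (g l),
            forall k l, L2 Omega (h k l) /\
              weak_partial k (a k l \* g l) (h k l) &
            eqL2 Omega v (fun x => \sum_k \sum_l h k l x)]].

Definition adjA (a : 'I_n -> 'I_n -> 'rV[R]_n -> R) :
    ('rV[R]_n -> R) -> ('rV[R]_n -> R) -> Prop :=
  adjoint (L2 Omega) (dotL2 Omega) (L2 Omega) (dotL2 Omega) (opA a).

End Sobolev.

Section Mittag_Leffler.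
Context (R : realType).

Definition Gamma (x : R) : R :=
  (\int[lebesgue_measure]_(t in `]0%R, +oo[) (t `^ (x - 1) * expR (- t)))%R.

Definition mittag_leffler (alpha x : R) : R :=
  limn (series (fun k => x ^+ k / Gamma (alpha * k%:R + 1))).

End Mittag_Leffler.

Section solution_operator.
Context (R : realType) (n : nat) (Omega : set 'rV[R]_n).
(* The i-th eigenvalue has multiplicity mult i and eigenfunctions phi i j. *)
Context (lam : nat -> R) (mult : nat -> nat)
  (phi : forall i : nat, 'I_(mult i) -> 'rV[R]_n -> R).
Implicit Types u v : 'rV[R]_n -> R.

Definition eigenprojection (i : nat) v : 'rV[R]_n -> R :=
  fun x => \sum_(j < mult i) dotL2 Omega v (phi j) * phi j x.

Definition orthonormal_basis : Prop :=
  (forall i (j : 'I_(mult i)), L2 Omega (phi j)) /\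
  (forall i (j : 'I_(mult i)) i' (j' : 'I_(mult i')),
     dotL2 Omega (phi j) (phi j') = ((i == i') && (j == j' :> nat))%:R) /\
  (forall v, L2 Omega v ->
     normL2 Omega ((fun x => \sum_(i < N) eigenprojection i v x) \- v)
       @[N --> \oo] --> (0 : R)).

Definition eigenbasis (a : 'I_n -> 'I_n -> 'rV[R]_n -> R) : Prop :=
  [/\ 0 < lam 0%N, forall i, lam i < lam i.+1, lam i @[i --> \oo] --> +oo,
      forall i, (0 < mult i)%N &
      (forall i (j : 'I_(mult i)),
         opA Omega a (phi j) (fun x => - lam i * phi j x)) /\
      orthonormal_basis].

(* Graph of S_alpha(t). *)
Definition opS (alpha t : R) v u : Prop :=
  [/\ L2 Omega v, L2 Omega u &
      normL2 Omega ((fun x => \sum_(i < N)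
          mittag_leffler alpha (- lam i * t `^ alpha) *
          eigenprojection i v x) \- u) @[N --> \oo] --> (0 : R)].

End solution_operator.

Section Hilbert_valued.
Context (R : realType) (O : normedModType R).

Definition hilbert_product (dot : O -> O -> R) : Prop :=
  [/\ forall x y, dot x y = dot y x,
      forall (c : R) x y w, dot (c *: x + y) w = c * dot x w + dot y w &
      forall x, dot x x = `|x| ^+ 2].

Definition simple_function (f : R -> O) : Prop :=
  finite_set (range f) /\
  forall o, measurable (f @^-1` [set o] : set (measurableTypeR R)).

Definition strongly_measurable (D : set R) (f : R -> O) : Prop :=
  exists s : nat -> R -> O, (forall k, simple_function (s k)) /\
    forall t, D t -> s k t @[k --> \oo] --> f t.

(* L^2(0, T; O); every class has a representative which is strongly measurable
   in the above sense. *)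
Definition L2T (T : R) : set (R -> O) :=
  [set z | strongly_measurable `]0, T[ z /\
    (\int[lebesgue_measure]_(t in `]0%R, T[) (`|z t| ^+ 2)%:E < +oo)%E].

Definition dotL2T (dot : O -> O -> R) (T : R) (z w : R -> O) : R :=
  (\int[lebesgue_measure]_(t in `]0%R, T[) (dot (z t) (w t)))%R.

End Hilbert_valued.

Section observation.
Context (R : realType) (n : nat) (Omega : set 'rV[R]_n)
  (O : normedModType R) (dot : O -> O -> R)
  (domC : set ('rV[R]_n -> R)) (C : ('rV[R]_n -> R) -> O).
Implicit Types u v : 'rV[R]_n -> R.

(* A linear operator on a subspace domC of L^2(Omega), no continuity being
   required. *)
Definition observation_operator : Prop :=
  [/\ domC `<=` L2 Omega, domC (cst 0),
      forall u v, domC u -> L2 Omega v -> eqL2 Omega u v ->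
        domC v /\ C v = C u &
      forall (c : R) u v, domC u -> domC v ->
        domC (fun x => c * u x + v x) /\
        C (fun x => c * u x + v x) = c *: C u + C v].

Definition opC u (o : O) : Prop := domC u /\ C u = o.

Definition adjC : O -> ('rV[R]_n -> R) -> Prop :=
  adjoint (L2 Omega) (dotL2 Omega) setT dot opC.

Context (lam : nat -> R) (mult : nat -> nat)
  (phi : forall i : nat, 'I_(mult i) -> 'rV[R]_n -> R) (alpha T : R).

(* Graph of v |-> C (S_alpha(.) v) on its natural domain in L^2(Omega). *)
Definition observation_map v (w : R -> O) : Prop :=
  [/\ L2 Omega v, L2T T w &
      {ae @lebesgue_measure R, forall t, `]0, T[%classic t ->
         exists2 u, opS Omega lam phi alpha t v u & opC u (w t)}].

Definition admissible : Prop :=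
  exists2 M : R, 0 < M & forall v, domA Omega v ->
    exists2 w, observation_map v w &
      (\int[lebesgue_measure]_(t in `]0%R, T[) (`|w t| ^+ 2))%R <=
        M * normL2 Omega v ^+ 2.

Context (domK : set ('rV[R]_n -> R)).

(* The domain of the observability operator contains D(A), where admissibility
   makes it defined, and is otherwise left free in the natural domain. *)
Definition observability_domain : Prop :=
  (forall v, domA Omega v -> domK v) /\
  (forall v, domK v -> exists w, observation_map v w).

Definition opK v (w : R -> O) : Prop := domK v /\ observation_map v w.

Definition adjK : (R -> O) -> ('rV[R]_n -> R) -> Prop :=
  adjoint (L2 Omega) (dotL2 Omega) (@L2T R O T) (dotL2T dot T) opK.

End observation.

Section fractional_calculus.
Context (R : realType) (n : nat) (Omega : set 'rV[R]_n) (T : R).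
Implicit Types (r w : R -> 'rV[R]_n -> R) (s : R).

Definition RL_kernel (beta s e : R) : R := (e - s) `^ (beta - 1) / Gamma beta.

(* Right-sided Riemann-Liouville integral, the identity for beta = 0. *)
Definition RL_integral (beta : R) r s : 'rV[R]_n -> R := fun y =>
  if beta == 0 then r s y
  else (\int[lebesgue_measure]_(e in `[s, T]) (RL_kernel beta s e * r e y))%R.

Definition RL_integrable (beta : R) r s : Prop :=
  beta = 0 \/
  {ae lebesgue_rV R n, forall y, Omega y ->
     (@lebesgue_measure R).-integrable `[s, T]
       (fun e => (RL_kernel beta s e * r e y)%:E)}.

Definition derivL2 w s (d : 'rV[R]_n -> R) : Prop :=
  L2 Omega d /\
  normL2 Omega (fun y => h^-1 * (w (s + h) y - w s y) - d y)
    @[h --> 0^'] --> (0 : R).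

(* d is the right-sided Riemann-Liouville derivative of r at s, the derivative
   with respect to time being taken in L^2(Omega). *)
Definition RL_derivative (alpha : R) r s (d : 'rV[R]_n -> R) : Prop :=
  derivL2 (RL_integral (1 - alpha) r) s (fun y => - d y).

Definition abs_continuousL2 w (a b : R) : Prop :=
  forall e : R, 0 < e -> exists2 d : R, 0 < d &
    forall (N : nat) (s t : 'I_N -> R),
      (forall i, [/\ a <= s i, s i <= t i & t i <= b]) ->
      (forall i j, i != j -> t i <= s j \/ t j <= s i) ->
      \sum_i (t i - s i) < d ->
      \sum_i normL2 Omega (w (t i) \- w (s i)) < e.

End fractional_calculus.

Section adjoint_problem.
Context (R : realType) (n : nat) (Omega : set 'rV[R]_n) (T alpha : R)
  (a : 'I_n -> 'I_n -> 'rV[R]_n -> R)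
  (O : normedModType R) (dot : O -> O -> R)
  (domC : set ('rV[R]_n -> R)) (C : ('rV[R]_n -> R) -> O)
  (z : R -> O) (r : R -> 'rV[R]_n -> R).

Local Notation w := (RL_integral T (1 - alpha) r).

(* Strong solution in L^2(Omega): r is in L^1(0, T; L^2(Omega)), its fractional
   integral w exists at all times of [0, T[, is locally absolutely continuous in
   ]0, T[ (without which the equation almost everywhere in time does not
   determine w) and continuous at the time 0 where it is evaluated. The
   Dirichlet condition is membership in H^1_0. *)
Record adjoint_solution : Prop := AdjointSolution {
  sol_measurable : measurable_fun (`]0, T[ `*` Omega)
    (fun p : measurableTypeR R * 'rV[R]_n => r p.1 p.2) ;
  sol_L2 : {ae @lebesgue_measure R, forall s, `]0, T[%classic s ->
    L2 Omega (r s)} ;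
  sol_L1 : (\int[lebesgue_measure]_(s in `]0%R, T[)
    (normL2 Omega (r s))%:E < +oo)%E ;
  sol_RL_integral : forall s, 0 <= s < T ->
    RL_integrable Omega T (1 - alpha) r s /\ L2 Omega (w s) ;
  sol_abs_continuous : forall s t, 0 < s -> t < T ->
    abs_continuousL2 Omega w s t ;
  sol_continuous0 :
    normL2 Omega (w s \- w 0) @[s --> 0^'+] --> (0 : R) ;
  sol_equation : {ae @lebesgue_measure R, forall s, `]0, T[%classic s ->
    exists Ar Cz, [/\ adjA Omega a (r s) Ar, adjC Omega dot domC C (z s) Cz &
      RL_derivative Omega T alpha r s (Ar \+ Cz)]} ;
  sol_boundary : {ae @lebesgue_measure R, forall s, `]0, T[%classic s ->
    H10 Omega (r s)} ;
  sol_terminal : normL2 Omega (w s) @[s --> T^'-] --> (0 : R) }.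

End adjoint_problem.

(* Main.v *)
Require Import Defs.
From HB Require Import structures.
From mathcomp Require Import all_boot all_order all_algebra.
From mathcomp Require Import all_classical all_reals all_analysis.
From mathcomp Require Import measurable_realfun ring lra.
Set Implicit Arguments.
Unset Strict Implicit.
Unset Printing Implicit Defensive.
Import Order.TTheory GRing.Theory Num.Theory.
Import numFieldNormedType.Exports.
Local Open Scope classical_set_scope.
Local Open Scope ring_scope.

(** The operator -A has an orthonormal basis of eigenfunctions, so two elements
    of L^2(Omega) coincide as soon as they have the same scalar product with
    every eigenfunction phi, say of eigenvalue lambda. Testing everything
    against phi reduces the theorem to a scalar identity on ]0, T[. Write

      rho(s) = <r(s), phi>,  W(s) = <(I^(1-alpha) r)(s), phi>,
      c(s) = <C phi, z(s)>,  E(t) = E_alpha (- lambda t^alpha).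

    Since S_alpha(t) phi = E(t) phi, the definition of the adjoint gives
    <phi, K^* z> = int_0^T E c (observation_eigenfunction), and what has to be
    shown is that W(0) = int_0^T E c (tested_initial_value).

    The adjoint equation yields W' = - f almost everywhere, with
    f = c - lambda rho. As W is locally absolutely continuous and vanishes at T,
    W(s) = int_s^T f and W(0) = int_0^T f (abs_cont_primitiveE,
    abs_cont_initial_value). On the other hand W = I^(1-alpha) rho almost
    everywhere, by Fubini (time_coef_RL_integral).

    The scalar identity int E c = int f (mittag_leffler_duality) is then proved
    term by term on the series of E, without solving the equation. Let
    k_x(t) = t^(x-1) / Gamma(x) on ]0, +oo[. The term of index k is
    (- lambda)^k int k_(alpha k + 1) c, and c = f + lambda rho. The semigroup law
    k_x * k_y = k_(x+y) (frac_kernel_convolution) and Fubini turn both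
    int k_(alpha (k+1) + 1) f and int k_(alpha k + 1) rho into
    int k_(alpha (k+1)) W, so that the series telescopes: its partial sums are
    int f minus a remainder, which tends to 0 because Gamma grows faster than
    any geometric sequence. Dominated convergence concludes. *)

(** * Integration on the real line *)

Section affine_substitution.
Context (R : realType).
Local Open Scope ereal_scope.
Notation mu := (@lebesgue_measure R).

Lemma measurable_affine (c b : R) :
  measurable_fun [set: measurableTypeR R]
    (fun x : measurableTypeR R => (c * x + b)%R : measurableTypeR R).
Proof.
apply: (@measurable_funD _ _ _ _ (fun x : R => (c * x)%R) (cst b)) => //.
by apply: (@measurable_funM _ _ _ _ (cst c) id).
Qed.

(** Lebesgue measure is the only measure with its values on intervals, hence it
    is c times its image under x |-> c x + b. *)
Lemma ge0_integral_affine (c b : R) (f : R -> \bar R) : (0 < c)%R ->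
  measurable_fun [set: R] f -> (forall x, 0 <= f x) ->
  c%:E * \int[mu]_x f (c * x + b)%R = \int[mu]_x f x.
Proof.
move=> c0 mf f0.
have mphi := measurable_affine c b.
pose phi : measurableTypeR R -> measurableTypeR R := fun x => (c * x + b)%R.
pose m : {measure set (measurableTypeR R) -> \bar R} :=
  measure_function_pushforward__canonical__measure_function_Measure mu mphi.
have c0' : (0 <= c)%R := ltW c0.
pose k : {nonneg R} := NngNum c0'.
have E A : measurable A -> mu A = mscale k m A.
  apply: lebesgue_measure_unique => _ [[u v] uv <-].
  rewrite -[RHS]/(c%:E * mu (phi @^-1` `]u, v]%classic)).
  rewrite (_ : _ @^-1` _ = `]((u - b) / c)%R, ((v - b) / c)%R]%classic); last first.
    apply/seteqP; split => x /=; rewrite !in_itv/= ltr_pdivrMr// ler_pdivlMr//;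
      by rewrite ltrBlDr lerBrDr mulrC.
  rewrite !lebesgue_measure_itv/= !lte_fin ltr_pM2r ?invr_gt0// ltrD2r.
  case: ifPn => _; last by rewrite mule0.
  by rewrite -!EFinD -EFinM; congr EFin; field; rewrite gt_eqF.
transitivity (\int[mscale k m]_x f x).
  rewrite ge0_integral_mscale//; congr (_ * _).
  by rewrite (ge0_integral_pushforward mphi) //= => y _; exact: f0.
by apply: eq_measure_integral => A mA _; exact/esym/E.
Qed.

End affine_substitution.

Section measurable_sections.
Context d1 d2 (T1 : measurableType d1) (T2 : measurableType d2) (R : realType).
Variable m2 : {sigma_finite_measure set T2 -> \bar R}.
Local Open Scope ereal_scope.

Lemma measurable_fun_integral_section (f : T1 * T2 -> \bar R) :
  measurable_fun setT f ->
  measurable_fun setT (fun x => \int[m2]_y f (x, y)).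
Proof.
move=> mf.
have -> : (fun x => \int[m2]_y f (x, y)) =
    (fun x => \int[m2]_y f^\+ (x, y)) \- (fun x => \int[m2]_y f^\- (x, y)).
  apply/funext => x; rewrite [LHS]integralE.
  under eq_integral do rewrite funepos_comp/=.
  by under [X in _ - X = _]eq_integral do rewrite funeneg_comp/=.
apply: emeasurable_funB.
- by apply: measurable_fun_fubini_tonelli_F => //; exact: measurable_funepos.
- by apply: measurable_fun_fubini_tonelli_F => //; exact: measurable_funeneg.
Qed.

Lemma measurable_fun_Rintegral_section (f : T1 * T2 -> R) :
  measurable_fun setT f ->
  measurable_fun setT (fun x => (\int[m2]_y f (x, y))%R).
Proof.
move=> mf; apply: measurableT_comp => //.
by apply: (@measurable_fun_integral_section (EFin \o f)); exact/measurable_EFinP.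
Qed.

End measurable_sections.

Section integrability_on_the_line.
Context (R : realType).
Notation mu := (@lebesgue_measure R).

Lemma le_normr_integrable (D : set R) (g h : R -> R) : measurable D ->
  measurable_fun D g -> mu.-integrable D (EFin \o h) ->
  (forall t, D t -> `|g t| <= `|h t|) -> mu.-integrable D (EFin \o g).
Proof.
move=> mD mg ih gh; apply: (@le_integrable _ _ _ mu _ mD _ _ _ _ ih).
  exact/measurable_EFinP.
by move=> t Dt; rewrite lee_fin gh.
Qed.

Lemma bounded_mul_integrable (B : R) (D : set R) (g h : R -> R) : measurable D ->
  measurable_fun D g -> mu.-integrable D (EFin \o h) ->
  (forall t, D t -> `|g t| <= B \/ h t = 0) ->
  mu.-integrable D (EFin \o (fun t => g t * h t)).
Proof.
move=> mD mg ih gB; have mh : measurable_fun D h.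
  by apply/measurable_EFinP; exact: measurable_int ih.
apply: (@le_normr_integrable _ _ (fun t => B * h t)) => //.
- exact: measurable_funM.
- by have := @integrableZl _ _ _ mu _ mD B _ ih.
- move=> t Dt; rewrite !normrM; have [gt|->] := gB t Dt; last by rewrite normr0 !mulr0.
  by rewrite ler_wpM2r// (le_trans gt)// ler_norm.
Qed.

Lemma ae_itv_witness (T d : R) (P : R -> Prop) : 0 < T -> 0 < d ->
  {ae mu, forall t, `]0, T[%classic t -> P t} -> exists t, [/\ 0 < t, t < d & P t].
Proof.
move=> T0 d0 aP; apply: contrapT => nP.
have m0 : 0 < Num.min T d by rewrite lt_min T0 d0.
have : mu.-negligible (`]0, Num.min T d[ : set R).
  apply: negligibleS aP => t /=; rewrite in_itv/= lt_min => /andP[t0 /andP[tT td]].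
  move=> H; apply: nP; exists t; split => //; apply: H.
  by rewrite /= in_itv/= t0.
move/negligibleP => /(_ (measurable_itv _)).
rewrite [LHS](@lebesgue_measure_itv R `]0, Num.min T d[) /= lte_fin m0 sube0.
by move=> [] /eqP; rewrite gt_eqF.
Qed.

End integrability_on_the_line.

(** * The Gamma function *)

Section Gamma_function.
Context (R : realType).
Notation mu := (@lebesgue_measure R).

(** The integrand may be unbounded at 0: the fundamental theorem of calculus is
    applied on [1 / (n + 1), 1], and monotone convergence gives the limit. *)
Lemma powR_integral_le (x : R) : 0 < x ->
  (\int[mu]_(t in `]0%R, 1%R]) (t `^ (x - 1))%:E <= (x^-1)%:E)%E.
Proof.
move=> x0.
pose F (n : nat) : set R := `[n.+1%:R^-1, 1]%classic.
have mp D : measurable_fun D (fun t : R => (t `^ (x - 1))%:E).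
  by apply/measurable_EFinP; apply: measurable_funTS; exact: measurable_powR.
have -> : `]0, 1]%classic = \bigcup_n F n.
  apply/seteqP; split => t; last first.
    move=> [n _]; rewrite /F/= !in_itv/= => /andP[t0 ->].
    by rewrite andbT (lt_le_trans _ t0)// invr_gt0.
  rewrite /= in_itv/= => /andP[t0 t1]; exists (Num.truncn (t^-1)) => //; rewrite /F/= in_itv/= t1 andbT.
  by rewrite invf_ple ?posrE//; apply: ltW; exact: truncnS_gt.
have H : (\int[mu]_(t in F i) (t `^ (x - 1))%:E)%E @[i --> \oo] -->
    (\int[mu]_(t in \bigcup_i F i) (t `^ (x - 1))%:E)%E.
  apply: ge0_nondecreasing_set_cvg_integral => //.
  - move=> n m nm; rewrite subsetEset => t; rewrite /F/= !in_itv/= => /andP[tn ->].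
    by rewrite andbT (le_trans _ tn)// lef_pV2 ?posrE// ler_nat.
  - by move=> i; exact: measurable_itv.
  - by move=> i; exact: mp.
  - by move=> i t _; rewrite lee_fin powR_ge0.
rewrite -(cvg_lim _ H)//; apply: lime_le; first by apply/cvg_ex; eexists; exact: H.
apply: nearW => n.
have [->|n0] := eqVneq n 0%N.
  by rewrite /F invr1 set_itv1 integral_set1 lee_fin invr_ge0 ltW.
have n1 : (n.+1%:R^-1 : R) < 1 by rewrite invf_lt1 ?ltr1n ?ltnS ?lt0n.
pose P t : R := t `^ x / x.
have dP (t : R) : 0 < t -> is_derive t (1 : R) P (t `^ (x - 1)).
  move=> t0; have -> : t `^ (x - 1) = x^-1 *: (x * t `^ (x - 1)).
    by rewrite /GRing.scale/= mulKf// gt_eqF.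
  have -> : P = x^-1 \*: (fun u : R => u `^ x).
    by apply/funext => u; rewrite /P mulrC.
  by apply: is_deriveZ; exact: is_derive1_powR.
have cP (t : R) : 0 < t -> {for t, continuous P}.
  by move=> t0; have [D _] := dP _ t0; exact/differentiable_continuous/derivable1_diffP.
have c1 (t : R) : 0 < t -> {for t, continuous (fun u : R => u `^ (x - 1))}.
  move=> t0; apply/differentiable_continuous/derivable1_diffP.
  by have [] := is_derive1_powR (x - 1) t0.
have nn : (0 : R) < n.+1%:R^-1 by rewrite invr_gt0.
rewrite (@continuous_FTC2 _ _ P)//.
- rewrite /P powR1 -EFinB lee_fin lerBlDr div1r lerDl divr_ge0// ?powR_ge0//.
  exact: ltW.
- apply: continuous_in_subspaceT => t; rewrite inE/= in_itv/= => /andP[nt _].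
  by apply: c1; exact: lt_le_trans nt.
- split.
  + move=> t; rewrite in_itv/= => /andP[nt _].
    by have [] := dP t (lt_trans nn nt).
  + by apply/cvg_at_right_filter; exact: cP.
  + by apply/cvg_at_left_filter; exact: cP.
- move=> t; rewrite in_itv/= => /andP[nt _]; rewrite derive1E.
  by have [] := dP t (lt_trans nn nt).
Qed.

Definition Gamma_integrand (x t : R) : R := t `^ (x - 1) * expR (- t).

Lemma measurable_Gamma_integrand (x : R) (D : set R) : measurable_fun D (Gamma_integrand x).
Proof.
apply: measurable_funTS; apply: measurable_funM; first exact: measurable_powR.
by apply: measurableT_comp => //; exact: measurable_expR.
Qed.

(** Near 0 the integrand is dominated by a power greater than -1; beyond 1, the
    exponential series bounds the power by a multiple of e^(t/2). *)
Lemma Gamma_integrable (x : R) : 0 < x ->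
  mu.-integrable `]0, +oo[ (EFin \o Gamma_integrand x).
Proof.
move=> x0; pose n := Num.truncn x.
pose K : R := 2 * (2 ^+ n.+1 * n.+1`!%:R).
have K0 : 0 <= K by rewrite !mulr_ge0// exprn_ge0.
pose p (t : R) : R := t `^ (x - 1).
have ip : mu.-integrable `]0, +oo[ (EFin \o (p \_ `]0, 1])).
  rewrite -restrict_EFin.
  apply/integrable_restrict => //=.
  rewrite setIidr; last by apply: subset_itvl.
  apply/integrableP; split.
    by apply/measurable_EFinP; apply: measurable_funTS; exact: measurable_powR.
  under eq_integral do rewrite /= ger0_norm ?powR_ge0//.
  exact: le_lt_trans (powR_integral_le x0) (ltry _).
have ie : mu.-integrable `]0, +oo[ (EFin \o (fun t => K * exponential_pdf (2^-1) t)).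
  have ie0 : mu.-integrable `]0, +oo[ (EFin \o exponential_pdf (2^-1)).
    apply: (@integrableS _ _ _ mu setT) => //. exact: integrable_exponential_pdf.
  by have := @integrableZl _ _ _ mu _ (measurable_itv _) K _ ie0.
have ipe := @integrableD _ _ _ mu _ (measurable_itv _) _ _ ip ie.
apply: (le_integrable _ _ _ ipe) => //.
  by apply/measurable_EFinP; exact: measurable_Gamma_integrand.
move=> t /=; rewrite in_itv/= andbT => t0.
rewrite lee_fin ger0_norm; last by rewrite mulr_ge0 ?powR_ge0 ?expR_ge0.
rewrite (le_trans _ (ler_norm _))//.
rewrite exponential_pdfE ?(ltW t0)//= patchE /Gamma_integrand /p.
have [t1|t1] := leP t 1.
  rewrite mem_set/= ?in_itv/= ?t0//.
  rewrite -[leLHS]addr0 lerD//.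
    by rewrite ler_piMr ?powR_ge0// expR_le1 oppr_le0 ltW.
  by rewrite !mulr_ge0// expR_ge0.
rewrite memNset; last by rewrite /= in_itv/= t0 leNgt t1.
rewrite add0r.
have -> : expR (- t) = (expR (t / 2))^-1 * expR (- 2^-1 * t).
  by rewrite -expRN -expRD; congr expR; field.
rewrite /K !mulrA ler_pM2r ?expR_gt0//.
rewrite ler_pdivrMr ?expR_gt0//.
have L1 : t `^ (x - 1) <= t ^+ n.+1.
  rewrite -powR_mulrn ?(ltW t0)//; apply: ler_powR; first exact: ltW.
  rewrite lerBlDr (le_trans (ltW (truncnS_gt _)))// lerDl//.
have := @expR_ge1Dxn _ (t / 2) n (divr_ge0 (ltW t0) (ler0n _ 2)).
set f := (n.+1)`!%:R : R.
move=> L2; apply: (le_trans L1).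
have f0 : 0 < f by rewrite ltr0n fact_gt0.
have L3 : (t / 2) ^+ n.+1 <= f * expR (t / 2).
  by rewrite [f * _]mulrC -ler_pdivrMr// (le_trans _ L2)// lerDr.
have -> : 2 * 2 ^+ n.+1 * f * 2^-1 * expR (t / 2) = 2 ^+ n.+1 * (f * expR (t/2)).
  by field.
rewrite -(@ler_pM2l _ (2 ^+ n.+1)) ?exprn_gt0// in L3.
by apply: le_trans L3; rewrite -exprMn mulrC divfK.
Qed.

Lemma Gamma_lower_bound (x a m : R) : 0 < x -> 0 < a -> 0 <= m ->
  (forall t, a <= t <= a + 1 -> m <= Gamma_integrand x t) -> m <= Gamma x.
Proof.
move=> x0 a0 m0 mg.
have -> : m = fine (\int[mu]_(t in `[a, (a + 1)%R]) m%:E).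
  rewrite integral_cst//= lebesgue_measure_itv/= lte_fin ltrDl ltr01.
  by rewrite -EFinB addrAC subrr add0r mule1.
have I1 := Gamma_integrable x0.
have sub : `[a, a + 1]%classic `<=` (`]0, +oo[%classic : set R).
  by move=> t /=; rewrite !in_itv/= andbT => /andP[at_ _]; exact: lt_le_trans at_.
rewrite /Gamma; apply: fine_le.
- rewrite integral_cst//= lebesgue_measure_itv/= lte_fin ltrDl ltr01.
  by rewrite -EFinB -EFinM.
- exact: integrable_fin_num.
- apply: (@le_trans _ _ (\int[mu]_(t in `[a, (a + 1)%R]) (Gamma_integrand x t)%:E)%E).
    apply: ge0_le_integral => //.
    by apply/measurable_EFinP; exact: measurable_Gamma_integrand.
  apply: ge0_subset_integral => //.
    by apply/measurable_EFinP; exact: measurable_Gamma_integrand.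
  by move=> t _; rewrite lee_fin mulr_ge0 ?powR_ge0 ?expR_ge0.
Qed.

Lemma Gamma_gt0 (x : R) : 0 < x -> 0 < Gamma x.
Proof.
move=> x0; apply: (@lt_le_trans _ _ (2^-1 * expR (- 2))).
  by rewrite mulr_gt0 ?expR_gt0.
apply: (@Gamma_lower_bound _ 1) => //.
move=> t /andP[t1 t2]; rewrite /Gamma_integrand ler_pM ?expR_ge0//.
  apply: (@le_trans _ _ (t `^ (-1))).
    by rewrite powR_inv1 ?(le_trans ler01)// lef_pV2 ?posrE//; lra.
  by apply: ler_powR => //; lra.
by rewrite ler_expR; lra.
Qed.

(** The integral over [M, M + 1] alone. As M is free, Gamma dominates every
    geometric sequence, which makes the Mittag-Leffler series converge. *)
Lemma Gamma_growth (M x : R) : 1 <= M -> 0 <= x ->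
  M `^ x * expR (- (M + 1)) <= Gamma (x + 1).
Proof.
move=> M1 x0; apply: (@Gamma_lower_bound _ M); [lra|lra| |].
  by rewrite mulr_ge0 ?powR_ge0 ?expR_ge0.
move=> t /andP[t1 t2]; rewrite /Gamma_integrand addrK ler_pM ?powR_ge0 ?expR_ge0//.
  by apply: ge0_ler_powR; rewrite ?nnegrE//; lra.
by rewrite ler_expR lerN2.
Qed.

Lemma Gamma1 : Gamma (1 : R) = 1.
Proof.
have E : (\int[mu]_(t in `]0%R, +oo[) (Gamma_integrand 1 t)%:E = 1)%E.
  rewrite -(@integral_exponential_pdf R 1)// integral_itv_obnd_cbnd; last first.
    by apply/measurable_EFinP; exact: measurable_Gamma_integrand.
  rewrite integral_mkcond; apply: eq_integral => t _; rewrite restrict_EFin/=.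
  congr EFin; rewrite patchE; case: ifPn => [|/negP] t0.
    rewrite exponential_pdfE/=; last by move: t0; rewrite inE/= in_itv/= andbT.
    by rewrite /Gamma_integrand subrr powRr0 mul1r mulN1r mul1r.
  rewrite lt0_exponential_pdf// ltNge; apply/negP => t1; apply: t0.
  by rewrite inE/= in_itv/= andbT.
by rewrite /Gamma /Rintegral E.
Qed.

End Gamma_function.

(** * Fractional kernels and their semigroup law *)

Section frac_kernel.
Context (R : realType).
Notation mu := (@lebesgue_measure R).
Implicit Types x y t s e : R.

(** The kernel of the fractional integral of order x, extended by 0 so that
    fractional integrals are convolutions on the whole line. *)
Definition frac_kernel x t : R := if 0 < t then t `^ (x - 1) / Gamma x else 0.

Notation fk := frac_kernel.

Lemma Gamma_ge0 x : 0 <= Gamma x.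
Proof.
by apply: Rintegral_ge0 => t _; rewrite mulr_ge0 ?powR_ge0 ?expR_ge0.
Qed.

Lemma frac_kernel_ge0 x t : 0 <= fk x t.
Proof. by rewrite /fk; case: ifPn => // _; rewrite divr_ge0 ?powR_ge0 ?Gamma_ge0. Qed.

Lemma frac_kernelE x t : 0 < t -> fk x t = t `^ (x - 1) / Gamma x.
Proof. by rewrite /fk => ->. Qed.

Lemma frac_kernel_eq0 x t : t <= 0 -> fk x t = 0.
Proof. by rewrite /fk ltNge => ->. Qed.

Lemma frac_kernel1 t : 0 < t -> fk 1 t = 1.
Proof. by move=> t0; rewrite frac_kernelE// Gamma1 subrr powRr0 divr1. Qed.

Lemma measurable_frac_kernel x : measurable_fun [set: measurableTypeR R] (fk x).
Proof.
have -> : fk x = (fun t => t `^ (x - 1) / Gamma x) \_ `]0, +oo[.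
  apply/funext => t; rewrite patchE; case: ifPn => [|/negP].
    by rewrite inE/= in_itv/= andbT => /frac_kernelE.
  by rewrite inE/= in_itv/= andbT => /negP; rewrite -leNgt => /frac_kernel_eq0.
apply/(measurable_restrictT _ _).1 => //; apply: measurable_funTS.
by apply: measurable_funM => //; exact: measurable_powR.
Qed.

Lemma measurable_frac_kernelB x :
  measurable_fun [set: measurableTypeR R * measurableTypeR R]
    (fun p : measurableTypeR R * measurableTypeR R => fk x (p.2 - p.1)).
Proof.
apply: (measurableT_comp (measurable_frac_kernel x)).
by apply: (@measurable_funB _ _ _ _ (fun p : R * R => p.2) (fun p : R * R => p.1));
  [exact: measurable_snd|exact: measurable_fst].
Qed.

Lemma measurable_frac_kernel_shift x s :
  measurable_fun [set: measurableTypeR R] (fun e : measurableTypeR R => fk x (e - s)).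
Proof.
apply: (measurableT_comp (measurable_frac_kernel x)).
by apply: (@measurable_funB _ _ _ _ id (cst s)).
Qed.

Lemma frac_kernelM x c t : 0 < c -> fk x (c * t) = c `^ (x - 1) * fk x t.
Proof.
move=> c0; rewrite /fk pmulr_rgt0//; case: ifPn => [t0|_]; last by rewrite mulr0.
by rewrite powRM ?(ltW c0) ?(ltW t0)// mulrA.
Qed.

Lemma integral_frac_kernel_expR x : 0 < x ->
  (\int[mu]_t (fk x t * expR (- t))%:E = 1)%E.
Proof.
move=> x0; have G0 := Gamma_gt0 x0; have IG := Gamma_integrable x0.
transitivity (\int[mu]_(t in `]0%R, +oo[)
    ((Gamma x)^-1%:E * (t `^ (x - 1) * expR (- t))%:E))%E.
  rewrite [RHS]integral_mkcond; apply: eq_integral => t _.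
  rewrite patchE; case: ifPn => [|/negP].
    rewrite inE/= in_itv/= andbT => t0.
    by rewrite frac_kernelE// -EFinM; congr EFin; rewrite mulrAC mulrC.
  rewrite inE/= in_itv/= andbT => /negP; rewrite -leNgt => t0.
  by rewrite frac_kernel_eq0// mul0r.
rewrite integralZl//.
rewrite -[X in (_ * X)%E]fineK; last exact: integrable_fin_num IG.
by rewrite -EFinM mulVf// gt_eqF.
Qed.

Let conv x y e : \bar R := (\int[mu]_s (fk x s * fk y (e - s))%:E)%E.

Let measurable_conv_integrand x y :
  measurable_fun [set: measurableTypeR R * measurableTypeR R]
    (fun p : measurableTypeR R * measurableTypeR R => fk x p.1 * fk y (p.2 - p.1)).
Proof.
apply: measurable_funM; last exact: measurable_frac_kernelB.
exact: measurableT_comp (measurable_frac_kernel x) measurable_fst.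
Qed.

Let measurable_conv_section x y e :
  measurable_fun [set: measurableTypeR R] (fun s : R => (fk x s * fk y (e - s))%:E).
Proof.
apply/measurable_EFinP.
exact: (measurableT_comp (measurable_conv_integrand x y) (pair2_measurable e)).
Qed.

(* homogeneity: the substitution s = e s' reduces the convolution at e to the
   convolution at 1 *)
Let conv_scale x y e : 0 < e ->
  conv x y e = ((e `^ (x + y - 1))%:E * conv x y 1)%E.
Proof.
move=> e0; rewrite /conv -(@ge0_integral_affine R e 0)//; last 2 first.
- exact: measurable_conv_section.
- by move=> s; rewrite lee_fin mulr_ge0 ?frac_kernel_ge0.
have en0 : e != 0 by rewrite gt_eqF.
have -> : e `^ (x + y - 1) = e * (e `^ (x - 1) * e `^ (y - 1)).
  rewrite -[X in X * _]powRr1 ?(ltW e0)// -!powRD ?en0 ?implybT//.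
  by congr powR; ring.
rewrite EFinM -muleA; congr (_ * _)%E.
rewrite -ge0_integralZl//.
- apply: eq_integral => s _; rewrite addr0 -EFinM; congr EFin.
  by rewrite -[e - _](_ : e * (1 - s) = _) ?frac_kernelM//; ring.
- by move=> s _; rewrite lee_fin mulr_ge0 ?frac_kernel_ge0.
- by rewrite lee_fin mulr_ge0 ?powR_ge0.
Qed.

Let conv_le0 x y e : e <= 0 -> conv x y e = 0%E.
Proof.
move=> e0; rewrite /conv integral0_eq// => s _; congr EFin.
have [s0|s0] := leP s 0; first by rewrite frac_kernel_eq0// mul0r.
by rewrite (frac_kernel_eq0 y) ?mulr0// subr_le0 (le_trans e0)// ltW.
Qed.

(* k_x(t) e^(-t) and k_y(t) e^(-t) have integral 1, hence so has their
   convolution, which is conv x y 1 * u^(x+y-1) e^(-u) on ]0, +oo[ *)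
Let conv1 x y : 0 < x -> 0 < y -> conv x y 1 = (Gamma (x + y))^-1%:E.
Proof.
move=> x0 y0; have xy0 : 0 < x + y by rewrite addr_gt0.
have G0 := Gamma_gt0 xy0.
have mexp : measurable_fun [set: measurableTypeR R] (fun t : R => expR (- t)).
  by apply: measurableT_comp => //; exact: measurable_expR.
pose F (p : measurableTypeR R * measurableTypeR R) : \bar R :=
  (fk x p.1 * fk y (p.2 - p.1) * expR (- p.2))%:E.
have mF : measurable_fun setT F.
  apply/measurable_EFinP; apply: measurable_funM; first exact: measurable_conv_integrand.
  exact: measurableT_comp mexp measurable_snd.
have F0 p : (0 <= F p)%E by rewrite lee_fin !mulr_ge0 ?frac_kernel_ge0 ?expR_ge0.
have E1 : (\int[mu]_s \int[mu]_u F (s, u) = 1)%E.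
  rewrite -[RHS](integral_frac_kernel_expR x0); apply: eq_integral => s _.
  rewrite -[RHS]mule1 -[X in (_ * X)%E](integral_frac_kernel_expR y0).
  have mg : measurable_fun setT (fun t : R => (fk y t * expR (- t))%:E).
    apply/measurable_EFinP; apply: measurable_funM => //; exact: measurable_frac_kernel.
  have g0 (t : R) : (0 <= (fk y t * expR (- t))%:E)%E.
    by rewrite lee_fin mulr_ge0 ?frac_kernel_ge0 ?expR_ge0.
  rewrite -(@ge0_integral_affine R 1 (- s) _ ltr01 mg g0) mul1e -ge0_integralZl//.
  - apply: eq_integral => u _; rewrite -EFinM; congr EFin => /=.
    rewrite mul1r -[- u](_ : - s + - (u - s) = _) ?expRD; last by ring.
    by ring.
  - exact: (measurableT_comp mg (measurable_affine 1 (- s))).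
  - by rewrite lee_fin mulr_ge0 ?frac_kernel_ge0 ?expR_ge0.
have E2 : (\int[mu]_s \int[mu]_u F (s, u) = conv x y 1 * (Gamma (x + y))%:E)%E.
  rewrite (@fubini_tonelli _ _ _ _ _ mu mu F mF F0).
  have IG := Gamma_integrable xy0.
  have -> : ((Gamma (x + y))%:E =
      \int[mu]_(u in `]0%R, +oo[) (u `^ (x + y - 1) * expR (- u))%:E)%E.
    by rewrite fineK//; exact: integrable_fin_num IG.
  rewrite -ge0_integralZl//; last 3 first.
  - by apply/measurable_EFinP; exact: measurable_Gamma_integrand.
  - by move=> u _; rewrite lee_fin mulr_ge0 ?powR_ge0 ?expR_ge0.
  - by apply: integral_ge0 => s _; rewrite lee_fin mulr_ge0 ?frac_kernel_ge0.
  rewrite [RHS]integral_mkcond; apply: eq_integral => u _.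
  have -> : (\int[mu]_s F (s, u) = conv x y u * (expR (- u))%:E)%E.
    rewrite -ge0_integralZr//.
    by move=> s _; rewrite lee_fin mulr_ge0 ?frac_kernel_ge0.
  rewrite patchE; case: ifPn => [|/negP].
    rewrite inE/= in_itv/= andbT => u0.
    by rewrite conv_scale// EFinM muleCA muleA.
  rewrite inE/= in_itv/= andbT => /negP; rewrite -leNgt => u0.
  by rewrite conv_le0// mul0e.
have : (conv x y 1 * (Gamma (x + y))%:E = 1)%E by rewrite -E2 E1.
move=> /(congr1 (fun z => z * (Gamma (x + y))^-1%:E)%E).
by rewrite -muleA -EFinM divff ?gt_eqF// mule1 mul1e.
Qed.

(** Euler's Beta integral, in the form of the semigroup law of the fractional
    integrals. *)
Lemma frac_kernel_convolution x y e : 0 < x -> 0 < y ->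
  (\int[mu]_s (fk x s * fk y (e - s))%:E = (fk (x + y) e)%:E)%E.
Proof.
move=> x0 y0; have [e0|e0] := leP e 0.
  by rewrite frac_kernel_eq0// -[LHS]/(conv x y e) conv_le0.
by rewrite -[LHS]/(conv x y e) conv_scale// conv1// frac_kernelE// EFinM.
Qed.

End frac_kernel.

Section fractional_fubini.
Context (R : realType).
Notation mu := (@lebesgue_measure R).
Notation fk := (@frac_kernel R).
Implicit Types x y t s e : R.

Variables (x y : R) (h : R -> R).
Hypotheses (x0 : 0 < x) (y0 : 0 < y) (mh : measurable_fun [set: R] h).
Hypothesis ih : mu.-integrable setT (EFin \o (fun e => fk (x + y) e * h e)).

Let F (p : measurableTypeR R * measurableTypeR R) : \bar R :=
  (fk x p.1 * fk y (p.2 - p.1) * h p.2)%:E.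

Let mF : measurable_fun setT F.
Proof.
apply/measurable_EFinP; apply: measurable_funM.
  apply: measurable_funM; last exact: measurable_frac_kernelB.
  exact: measurableT_comp (measurable_frac_kernel x) measurable_fst.
exact: measurableT_comp mh measurable_snd.
Qed.

Let conv_integrable e :
  mu.-integrable setT (EFin \o (fun s => fk x s * fk y (e - s))).
Proof.
have k0 s : 0 <= fk x s * fk y (e - s) by rewrite mulr_ge0 ?frac_kernel_ge0.
apply/integrableP; split.
  apply/measurable_EFinP; apply: measurable_funM; first exact: measurable_frac_kernel.
  exact: (measurableT_comp (measurable_frac_kernelB y) (pair2_measurable e)).
under eq_integral do rewrite gee0_abs ?lee_fin//=.
by rewrite frac_kernel_convolution// ltry.
Qed.

Let integrable_F : (mu \x mu)%E.-integrable setT F.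
Proof.
apply/integrable21ltyP => //.
have /integrableP[_] := ih; congr (_ < _)%E; apply: eq_integral => e _ /=.
under eq_integral do rewrite normrM EFinM ger0_norm ?mulr_ge0 ?frac_kernel_ge0//.
rewrite integralZr//; last exact: conv_integrable.
by rewrite frac_kernel_convolution// -EFinM normrM (ger0_norm (frac_kernel_ge0 _ _)).
Qed.

Lemma frac_kernel_ae_integrable :
  {ae mu, forall s, 0 < s ->
    mu.-integrable setT (EFin \o (fun e => fk y (e - s) * h e))}.
Proof.
have := ae_integrable1 integrable_F.
apply: filterS => s Fs s0.
have ks : 0 < fk x s by rewrite frac_kernelE// divr_gt0 ?powR_gt0 ?Gamma_gt0.
have := integrableZl measurableT (fk x s)^-1 Fs.
apply: eq_integrable => // e _; rewrite -EFinM /=; congr EFin.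
by rewrite -!mulrA mulKf// gt_eqF.
Qed.

(** W is a fractional integral of h of order y, known almost everywhere only:
    integrating it against k_x moves the kernel onto h, by Fubini and the
    semigroup law. *)
Lemma frac_kernel_fubini (W : R -> R) : measurable_fun [set: R] W ->
  {ae mu, forall s, 0 < s -> W s = \int[mu]_e (fk y (e - s) * h e)} ->
  \int[mu]_s (fk x s * W s) = \int[mu]_e (fk (x + y) e * h e).
Proof.
move=> mW WE; congr fine.
transitivity (\int[mu]_s \int[mu]_e F (s, e))%E.
  apply: ae_eq_integral => //.
  - apply/measurable_EFinP; apply: measurable_funM => //.
    exact: measurable_frac_kernel.
  - exact: (measurable_fubini_F integrable_F).
  move: WE frac_kernel_ae_integrable; apply: filterS2.
    exact: (ae_filter_ringOfSetsType mu).
  move=> s Ws is_ _.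
  have [s0|s0] := leP s 0.
    rewrite frac_kernel_eq0// mul0r integral0_eq// => e _.
    by rewrite /F/= frac_kernel_eq0// !mul0r.
  rewrite Ws// EFinM /Rintegral fineK; last exact: integrable_fin_num (is_ s0).
  rewrite -integralZl//; last exact: is_.
  by apply: eq_integral => e _; rewrite /F/= -EFinM mulrA.
rewrite (Fubini integrable_F); apply: eq_integral => e _; rewrite /F/=.
under eq_integral do rewrite EFinM.
by rewrite integralZr//; [rewrite frac_kernel_convolution|exact: conv_integrable].
Qed.

End fractional_fubini.

(** * The Mittag-Leffler series *)

Section Mittag_Leffler_series.
Context (R : realType).
Implicit Types (alpha q x M K : R) (k N : nat).

Notation ml alpha x := (fun k => x ^+ k / Gamma (alpha * k%:R + 1)).

Lemma Gamma_coef_gt0 alpha k : 0 < alpha -> 0 < Gamma (alpha * k%:R + 1).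
Proof.
by move=> a0; apply: Gamma_gt0; rewrite ltr_wpDl ?mulr_ge0 ?ler0n ?(ltW a0).
Qed.

(** M is chosen so that M^alpha = 2 q + 1 in the lower bound for Gamma; the ratio
    of the geometric bound is then q / (2 q + 1) <= 1 / 2. *)
Lemma mittag_leffler_coef_le alpha q : 0 < alpha -> 0 <= q ->
  exists2 K, 0 <= K & forall k, ml alpha q k <= K * 2^-1 ^+ k.
Proof.
move=> a0 q0; pose b := 2 * q + 1; pose M := b `^ alpha^-1.
have b1 : 1 <= b by rewrite /b lerDr mulr_ge0.
have b0 : 0 < b := lt_le_trans ltr01 b1.
have M1 : 1 <= M.
  by rewrite /M -(powRr0 b) ler_powR// invr_ge0 ltW.
have Ma k : M `^ (alpha * k%:R) = b ^+ k.
  by rewrite /M -powRrM mulrA mulVf ?gt_eqF// mul1r powR_mulrn// ltW.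
exists (expR (M + 1)); first exact: expR_ge0.
move=> k; rewrite ler_pdivrMr ?Gamma_coef_gt0//.
have := @Gamma_growth R M (alpha * k%:R) M1 (mulr_ge0 (ltW a0) (ler0n _ _)).
rewrite Ma expRN ler_pdivrMr ?expR_gt0// => H.
rewrite mulrAC [expR _ * _]mulrC.
apply: (@le_trans _ _ (b ^+ k * 2^-1 ^+ k)); last first.
  by rewrite ler_wpM2r// exprn_ge0.
rewrite -exprMn lerXn2r ?nnegrE ?mulr_ge0 ?(ltW b0)//.
by rewrite /b mulrDl mulrAC mulfV// mul1r lerDl.
Qed.

Lemma mittag_leffler_partial_sum_le alpha q : 0 < alpha -> 0 <= q ->
  exists2 K, 0 <= K & forall N, \sum_(0 <= k < N) ml alpha q k <= K.
Proof.
move=> a0 q0; have [K K0 Kq] := mittag_leffler_coef_le a0 q0.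
exists (K * 2) => [|N]; first by rewrite mulr_ge0.
apply: (@le_trans _ _ (\sum_(0 <= k < N) K * 2^-1 ^+ k)); first exact: ler_sum.
rewrite -mulr_sumr ler_wpM2l//.
have -> : \sum_(0 <= k < N) 2^-1 ^+ k = 2 - 2 * 2^-1 ^+ N :> R.
  elim: N => [|N IH]; first by rewrite big_geq// expr0 mulr1 subrr.
  by rewrite big_nat_recr//= IH exprS; field.
by rewrite gerBl mulr_ge0// exprn_ge0.
Qed.

Lemma mittag_leffler_cvg alpha x : 0 < alpha ->
  series (ml alpha x) @ \oo --> mittag_leffler alpha x.
Proof.
move=> a0; apply: normed_cvg.
have [K K0 Kq] := mittag_leffler_coef_le a0 (normr_ge0 x).
apply: (@series_le_cvg _ _ (geometric K 2^-1)) => [k|k|k|].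
- exact: normr_ge0.
- by rewrite mulr_ge0// exprn_ge0.
- rewrite /= normrM normrX (ger0_norm (_ : 0 <= (Gamma _)^-1)) ?Kq//.
  by rewrite invr_ge0 ltW// Gamma_coef_gt0.
- by apply: is_cvg_geometric_series; rewrite ger0_norm// invf_lt1// ltr1n.
Qed.

Lemma measurable_mittag_leffler alpha (lam : R) (D : set R) : 0 < alpha ->
  measurable_fun D (fun t => mittag_leffler alpha (lam * t `^ alpha)).
Proof.
move=> a0; apply: measurable_funTS.
have mx : measurable_fun [set: R] (fun t => lam * t `^ alpha).
  by apply: measurable_funM => //; exact: measurable_powR.
apply: (@measurable_fun_cvg _ _ _ _
    (fun N t => \sum_(0 <= k < N) ml alpha (lam * t `^ alpha) k)).
  move=> N; apply: measurable_sum => k; apply: measurable_funM => //.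
  exact: measurable_funX.
by move=> t _; exact: mittag_leffler_cvg.
Qed.

Lemma mittag_leffler_term_cvg0 alpha q : 0 < alpha -> 0 <= q ->
  ml alpha q k @[k --> \oo] --> 0.
Proof.
move=> a0 q0; apply: cvg_series_cvg_0.
by apply/cvg_ex; eexists; exact: mittag_leffler_cvg.
Qed.

(** All terms but the first contain the factor x. *)
Lemma mittag_leffler_near0 alpha : 0 < alpha ->
  exists2 K, 0 <= K & forall x, `|x| <= 1 -> `|mittag_leffler alpha x - 1| <= K * `|x|.
Proof.
move=> a0; have [K K0 Kq] := mittag_leffler_partial_sum_le a0 (@ler01 R).
exists K => // x x1.
have C : series (ml alpha x) N - 1 @[N --> \oo] --> mittag_leffler alpha x - 1.
  by apply: cvgB; [exact: mittag_leffler_cvg|exact: cvg_cst].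
rewrite -(cvg_lim (@Rhausdorff R) (cvg_norm C)).
apply: limr_le; first by apply/cvg_ex; eexists; exact: cvg_norm C.
near=> N; have N0 : (0 < N)%N by near: N; exact: nbhs_infty_gt.
rewrite -(prednK N0) /series /= big_nat_recl//= mulr0 add0r Gamma1 expr0 divr1.
rewrite addrAC subrr add0r (le_trans (ler_norm_sum _ _ _))//.
apply: (@le_trans _ _ (\sum_(0 <= k < N.-1) ml alpha 1 k.+1 * `|x|)).
  apply: ler_sum => k _; rewrite normrM normrX.
  rewrite (ger0_norm (_ : 0 <= (Gamma _)^-1)); last by rewrite invr_ge0 ltW// Gamma_coef_gt0.
  rewrite mulrAC ler_wpM2r//; first by rewrite invr_ge0 ltW// Gamma_coef_gt0.
  by rewrite expr1n mul1r exprS ler_piMr// exprn_ile1.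
rewrite -mulr_suml ler_wpM2r// (le_trans _ (Kq N))//.
rewrite -[in leRHS](prednK N0) big_nat_recl//= lerDr.
by rewrite mulr_ge0// invr_ge0 ltW// Gamma_coef_gt0.
Unshelve. all: by end_near. Qed.

End Mittag_Leffler_series.

(** * Duality for the scalar fractional equation *)

Lemma sum_alternating_telescope (R : comRingType) (l : R) (a : nat -> R) N :
  \sum_(0 <= k < N) (- l) ^+ k * (a k + l * a k.+1) = a 0%N - (- l) ^+ N * a N.
Proof.
elim: N => [|N IH]; first by rewrite big_geq// expr0 mul1r subrr.
by rewrite big_nat_recr//= IH exprS; ring.
Qed.

Section scalar_duality.
Context (R : realType).
Notation mu := (@lebesgue_measure R).
Notation fk := (@frac_kernel R).
Implicit Types x y t s e : R.

Variables (alpha lam T : R) (rho c : R -> R).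
Hypotheses (alpha_gt0 : 0 < alpha) (alpha_le1 : alpha <= 1) (lam_ge0 : 0 <= lam).
Hypothesis T_gt0 : 0 < T.
Hypothesis irho : mu.-integrable setT (EFin \o rho).
Hypothesis ic : mu.-integrable setT (EFin \o c).
Hypothesis rho0 : forall t, t <= 0 \/ T <= t -> rho t = 0.
Hypothesis c0 : forall t, t <= 0 \/ T <= t -> c t = 0.

Let f t := c t - lam * rho t.
Let P x (h : R -> R) := \int[mu]_t (fk x t * h t).

(* the fractional equation integrated once: int_s^T f = I^(1-alpha) rho, where
   I^0 is the identity *)
Hypothesis balance : {ae mu, forall s, 0 < s -> \int[mu]_e (fk 1 (e - s) * f e) =
  if alpha == 1 then rho s else \int[mu]_e (fk (1 - alpha) (e - s) * rho e)}.

Let ilrho : mu.-integrable setT (EFin \o (fun t => lam * rho t)).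
Proof. by have := @integrableZl _ _ _ mu _ measurableT lam _ irho. Qed.

Let if_ : mu.-integrable setT (EFin \o f).
Proof. by have := @integrableB _ _ _ mu _ measurableT _ _ ic ilrho. Qed.

Let measurable_of_integrable (h : R -> R) :
  mu.-integrable setT (EFin \o h) -> measurable_fun setT h.
Proof. by move=> ih; apply/measurable_EFinP; exact: measurable_int ih. Qed.

Let f0 t : t <= 0 \/ T <= t -> f t = 0.
Proof. by move=> H; rewrite /f rho0// c0// mulr0 subrr. Qed.

Let kernel_le k t : t <= T -> fk (alpha * k%:R + 1) t <=
  (T `^ alpha) ^+ k / Gamma (alpha * k%:R + 1).
Proof.
move=> tT; have [t0|t0] := leP t 0.
  by rewrite frac_kernel_eq0// divr_ge0 ?exprn_ge0 ?powR_ge0 ?Gamma_ge0.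
rewrite frac_kernelE// addrK ler_wpM2r ?invr_ge0 ?Gamma_ge0//.
rewrite -powR_mulrn ?powR_ge0// -powRrM.
by apply: ge0_ler_powR; rewrite ?nnegrE ?mulr_ge0 ?(ltW alpha_gt0)// ltW.
Qed.

Let integrable_kernel k (h : R -> R) : mu.-integrable setT (EFin \o h) ->
  (forall t, t <= 0 \/ T <= t -> h t = 0) ->
  mu.-integrable setT (EFin \o (fun t => fk (alpha * k%:R + 1) t * h t)).
Proof.
move=> ih h0.
apply: (@bounded_mul_integrable _ ((T `^ alpha) ^+ k / Gamma (alpha * k%:R + 1))) => //.
  exact: measurable_frac_kernel.
move=> t _; have [tT|tT] := leP t T; last by right; rewrite h0//; right; exact: ltW.
by left; rewrite ger0_norm ?frac_kernel_ge0// kernel_le.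
Qed.

Let W s := \int[mu]_e (fk 1 (e - s) * f e).

Let mW : measurable_fun [set: R] W.
Proof.
pose F (p : measurableTypeR R * measurableTypeR R) := fk 1 (p.2 - p.1) * f p.2.
apply: (@measurable_fun_Rintegral_section _ _ _ _ _ mu F).
apply: measurable_funM; first exact: measurable_frac_kernelB.
exact: measurableT_comp (measurable_of_integrable if_) measurable_snd.
Qed.

(* both sides are the integral of k_(alpha (k+1)) against W, read with the two
   expressions of W in balance *)
Let moment_shift k : P (alpha * k.+1%:R + 1) f = P (alpha * k%:R + 1) rho.
Proof.
set b := alpha * k.+1%:R.
have b0 : 0 < b by rewrite mulr_gt0.
have bk : alpha * k%:R + 1 = b + (1 - alpha).
  by rewrite /b -addn1 natrD mulrDr mulr1; ring.
have -> : P (b + 1) f = \int[mu]_s (fk b s * W s).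
  apply/esym/frac_kernel_fubini => //; first exact: measurable_of_integrable.
    exact: integrable_kernel.
  by apply: aeW => s _.
have [a1|a1] := eqVneq alpha 1.
  rewrite /P bk a1 subrr addr0; congr fine; apply: ae_eq_integral => //.
  - by apply/measurable_EFinP; apply: measurable_funM => //; exact: measurable_frac_kernel.
  - apply/measurable_EFinP; apply: measurable_funM; first exact: measurable_frac_kernel.
    exact: measurable_of_integrable.
  move: balance; apply: filterS; first exact: (ae_filter_ringOfSetsType mu).
  move=> s; rewrite a1 eqxx => Ws _.
  have [s0|s0] := leP s 0; first by rewrite frac_kernel_eq0// !mul0r.
  by rewrite /W Ws.
rewrite bk; apply: frac_kernel_fubini => //.
- by rewrite subr_gt0 lt_neqAle a1.
- exact: measurable_of_integrable.
- by rewrite -bk; exact: integrable_kernel.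
- by move: balance; rewrite (negbTE a1).
Qed.

Let moment_c k :
  P (alpha * k%:R + 1) c = P (alpha * k%:R + 1) f + lam * P (alpha * k%:R + 1) rho.
Proof.
rewrite /P -RintegralZl//; last exact: integrable_kernel.
rewrite -RintegralD//.
- by apply: eq_Rintegral => t _; rewrite /f; ring.
- exact: integrable_kernel.
- by have := @integrableZl _ _ _ mu _ measurableT lam _ (integrable_kernel k irho rho0).
Qed.

Let moment_sum N : \sum_(0 <= k < N) (- lam) ^+ k * P (alpha * k%:R + 1) c =
  P 1 f - (- lam) ^+ N * P (alpha * N%:R + 1) f.
Proof.
have -> : P 1 f = P (alpha * 0%:R + 1) f by rewrite mulr0 add0r.
rewrite (eq_bigr (fun k => (- lam) ^+ k *
  (P (alpha * k%:R + 1) f + lam * P (alpha * k.+1%:R + 1) f))).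
  exact: (sum_alternating_telescope lam (fun k => P (alpha * k%:R + 1) f)).
by move=> k _; rewrite moment_c moment_shift.
Qed.

Let remainder_cvg0 : (- lam) ^+ N * P (alpha * N%:R + 1) f @[N --> \oo] --> 0.
Proof.
pose I := \int[mu]_t `|f t|.
have q0 : 0 <= lam * T `^ alpha by rewrite mulr_ge0 ?powR_ge0.
have : (lam * T `^ alpha) ^+ N / Gamma (alpha * N%:R + 1) * I @[N --> \oo] --> 0.
  rewrite -(mul0r I); apply: cvgMl; exact: mittag_leffler_term_cvg0.
move=> B0; apply: norm_cvg0; apply: (squeeze_cvgr _ _ B0); last exact: cvg_cst.
apply: nearW => N; rewrite normr_ge0/= normrM normrX normrN (ger0_norm lam_ge0).
rewrite exprMn -!mulrA ler_wpM2l ?exprn_ge0// mulrA.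
set B := (T `^ alpha) ^+ N / _.
have iB : mu.-integrable setT (EFin \o (fun t => B * `|f t|)).
  by have := @integrableZl _ _ _ mu _ measurableT B _ (integrable_norm if_).
have iN := integrable_kernel N if_ f0.
apply: (le_trans (le_normr_Rintegral measurableT iN)).
rewrite /I -RintegralZl//; last exact: (integrable_norm if_).
apply: le_Rintegral => //; first exact: (integrable_norm iN).
move=> t _; rewrite normrM (ger0_norm (frac_kernel_ge0 _ _)).
have [tT|tT] := leP t T; first by rewrite ler_wpM2r// kernel_le.
by rewrite f0 ?normr0 ?mulr0//; right; exact: ltW.
Qed.

(** The moments of c against the kernels of the series telescope, and only the
    zeroth moment of f remains. *)
Lemma mittag_leffler_duality :
  \int[mu]_t (mittag_leffler alpha (- lam * t `^ alpha) * c t) = \int[mu]_t f t.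
Proof.
pose S N t := \sum_(0 <= k < N) (- lam * t `^ alpha) ^+ k / Gamma (alpha * k%:R + 1).
have mS N : measurable_fun setT (S N).
  apply: measurable_sum => k; apply: measurable_funM => //.
  apply: measurable_funX; apply: measurable_funM => //; exact: measurable_powR.
have mc := measurable_of_integrable ic.
have q0 : 0 <= lam * T `^ alpha by rewrite mulr_ge0 ?powR_ge0.
have [K K0 KS] := mittag_leffler_partial_sum_le alpha_gt0 q0.
have SK N t : `|S N t * c t| <= K * `|c t|.
  have [t0|t0] := leP t 0; first by rewrite c0 ?mulr0 ?normr0 ?mulr0//; left.
  have [tT|tT] := leP T t; first by rewrite c0 ?mulr0 ?normr0 ?mulr0//; right.
  rewrite normrM ler_wpM2r// (le_trans (ler_norm_sum _ _ _))//.
  rewrite (le_trans _ (KS N))//; apply: ler_sum => k _.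
  rewrite normrM normrX normrM normrN (ger0_norm lam_ge0) (ger0_norm (powR_ge0 _ _)).
  rewrite (ger0_norm (_ : 0 <= (Gamma _)^-1)) ?invr_ge0 ?Gamma_ge0//.
  rewrite ler_wpM2r ?invr_ge0 ?Gamma_ge0// lerXn2r ?nnegrE ?mulr_ge0 ?powR_ge0//.
  by rewrite ler_wpM2l// ge0_ler_powR ?nnegrE ?(ltW alpha_gt0)// ltW.
have Scvg t : (fun N => S N t * c t) @ \oo -->
    mittag_leffler alpha (- lam * t `^ alpha) * c t.
  by apply: cvgMl; exact: mittag_leffler_cvg.
have SP N : \int[mu]_t (S N t * c t) =
    P 1 f - (- lam) ^+ N * P (alpha * N%:R + 1) f.
  rewrite -moment_sum.
  transitivity (\int[mu]_t (\sum_(0 <= k < N)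
      (- lam) ^+ k * (fk (alpha * k%:R + 1) t * c t))).
    apply: eq_Rintegral => t _; rewrite /S mulr_suml; apply: eq_bigr => k _.
    have [t0|t0] := leP t 0; first by rewrite c0 ?mulr0//; left.
    rewrite frac_kernelE// addrK exprMn.
    have -> : t `^ (alpha * k%:R) = (t `^ alpha) ^+ k.
      by rewrite powRrM powR_mulrn ?powR_ge0.
    by rewrite !mulrA.
  rewrite /Rintegral.
  under eq_integral do rewrite -sumEFin.
  have ik k : mu.-integrable setT (fun t =>
      ((- lam) ^+ k * (fk (alpha * k%:R + 1) t * c t))%:E).
    by have := @integrableZl _ _ _ mu _ measurableT ((- lam) ^+ k) _ (integrable_kernel k ic c0).
  rewrite integral_sum// -sum_fine; last by move=> k _; exact: integrable_fin_num (ik k).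
  apply: eq_bigr => k _; rewrite -[LHS]/(\int[mu]_t _).
  by rewrite RintegralZl//; exact: integrable_kernel.
pose E t := mittag_leffler alpha (- lam * t `^ alpha) * c t.
have mSc N : measurable_fun setT (fun t => S N t * c t) by exact: measurable_funM.
have mE : measurable_fun setT E.
  by apply: measurable_funM => //; exact: measurable_mittag_leffler.
have iKc : mu.-integrable setT (fun t => (K * `|c t|)%:E).
  by have := @integrableZl _ _ _ mu _ measurableT K _ (integrable_norm ic).
have H1 N : measurable_fun setT (fun t => (S N t * c t)%:E) by exact/measurable_EFinP.
have H2 : measurable_fun setT (EFin \o E) by exact/measurable_EFinP.
have H3 : {ae mu, forall t, [set: R] t -> (S N t * c t)%:E @[N --> \oo] --> (E t)%:E}.
  by apply: aeW => t _; apply: cvg_EFin; [exact: nearW|exact: Scvg].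
have H4 : {ae mu, forall t N, [set: R] t -> (`|(S N t * c t)%:E| <= (K * `|c t|)%:E)%E}.
  by apply: aeW => t N _; rewrite lee_fin SK.
have [iE _ DC] := @dominated_convergence _ _ _ mu setT measurableT _ (EFin \o E) _ H1 H2 H3 iKc H4.
have iE' : (\int[mu]_t (E t)%:E)%E = (\int[mu]_t E t)%:E.
  by rewrite fineK//; exact: integrable_fin_num iE.
rewrite iE' in DC; have {DC} := @fine_cvg _ _ _ eventually_filter _ _ DC.
rewrite (_ : fine \o _ = fun N => P 1 f - (- lam) ^+ N * P (alpha * N%:R + 1) f); last first.
  by apply/funext => N; rewrite -SP.
move=> H; rewrite -[LHS](cvg_lim (@Rhausdorff R) H).
apply: cvg_lim => //.
have -> : \int[mu]_t f t = P 1 f - 0.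
  rewrite subr0; apply: eq_Rintegral => t _.
  have [t0|t0] := leP t 0; first by rewrite f0 ?mulr0//; left.
  by rewrite frac_kernel1// mul1r.
by apply: cvgB; [exact: cvg_cst|exact: remainder_cvg0].
Qed.

End scalar_duality.

(** * Absolutely continuous functions *)

Section absolute_continuity.
Context (R : realType).
Notation mu := (@lebesgue_measure R).
Implicit Types (F G g : R -> R) (a b c s t x : R).

Definition abs_cont F a b : Prop :=
  forall e : R, 0 < e -> exists2 d : R, 0 < d &
    forall (N : nat) (s t : 'I_N -> R),
      (forall i, [/\ a <= s i, s i <= t i & t i <= b]) ->
      (forall i j, i != j -> t i <= s j \/ t j <= s i) ->
      \sum_i (t i - s i) < d ->
      \sum_i `|F (t i) - F (s i)| < e.

Lemma abs_contB F G a b : abs_cont F a b -> abs_cont G a b ->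
  abs_cont (fun x => F x - G x) a b.
Proof.
move=> aF aG e e0; have e2 : 0 < e / 2 by rewrite divr_gt0.
have [d1 d10 H1] := aF _ e2; have [d2 d20 H2] := aG _ e2.
exists (Num.min d1 d2) => [|N s t st dj]; first by rewrite lt_min d10 d20.
rewrite lt_min => /andP[S1 S2].
apply: (@le_lt_trans _ _ (\sum_i (`|F (t i) - F (s i)| + `|G (t i) - G (s i)|))).
  apply: ler_sum => i _.
  have -> : F (t i) - G (t i) - (F (s i) - G (s i)) =
    (F (t i) - F (s i)) - (G (t i) - G (s i)) by ring.
  exact: ler_normB.
by rewrite big_split/= (splitr e) ltrD ?H1 ?H2.
Qed.

(** The sum of the increments is at most the integral of |g| over the union of the
    intervals, which is small because the integral is absolutely continuous
    with respect to the measure. *)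
Lemma abs_cont_Rintegral g a b : mu.-integrable setT (EFin \o g) ->
  abs_cont (fun x => \int[mu]_(t in `]-oo, x]) g t) a b.
Proof.
move=> ig e e0; have [d [d0 Hd]] := integral_normr_continuous ig e0.
exists d => // N s t st dj S.
pose I i : set R := `]s i, t i]%classic.
have mI i : measurable (I i) by exact: measurable_itv.
have tI : trivIset [set` index_enum 'I_N] I.
  apply/trivIsetP => i j _ _ ij; apply/seteqP; split => // x [].
  rewrite /I/= !in_itv/= => /andP[s1 t1] /andP[s2 t2].
  case: (dj i j ij) => H.
    by move: (le_lt_trans (le_trans t1 H) s2); rewrite ltxx.
  by move: (le_lt_trans (le_trans t2 H) s1); rewrite ltxx.
pose D : set R := \big[setU/set0]_(i <- index_enum 'I_N) I i.
have mD : measurable D by exact: bigsetU_measurable.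
have big_int (h : R -> R) : measurable_fun [set: R] h -> (forall x, 0 <= h x) ->
    (\int[mu]_(x in D) (h x)%:E = \sum_i \int[mu]_(x in I i) (h x)%:E)%E.
  move=> mh h0; apply: ge0_integral_bigsetU => //.
  - exact: index_enum_uniq.
  - by apply/measurable_EFinP; exact: measurable_funTS.
  - by move=> x _; rewrite lee_fin.
have muD : (mu D < d%:E)%E.
  have -> : mu D = (\sum_i (t i - s i))%:E.
    rewrite -(mul1e (mu D)) -(integral_cst mu mD) (big_int (cst 1))//.
    rewrite -sumEFin; apply: eq_bigr => i _.
    rewrite -[LHS]/(\int[mu]_(x in I i) cst 1%:E x)%E (integral_cst mu (mI i)) mul1e.
    rewrite [LHS](@lebesgue_measure_itv R `]s i, t i]) /= lte_fin.
    have [_ st1 _] := st i.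
    by case: ltgtP st1 => // -> _; rewrite subrr.
  by rewrite lte_fin.
have ign : mu.-integrable setT (EFin \o (fun x => `|g x|)) := integrable_norm ig.
have mg : measurable_fun [set: R] (fun x => `|g x|).
  by apply/measurable_EFinP; exact: measurable_int ign.
apply: le_lt_trans (Hd _ mD muD).
rewrite [leRHS]/Rintegral big_int// -sum_fine; last first.
  move=> i _; apply: integrable_fin_num => //.
    exact: mI.
  by have := @integrableS _ _ _ mu _ _ (fun x => `|g x|%:E) measurableT (mI i) (@subsetT _ _) ign.
apply: ler_sum => i _; have [_ st1 _] := st i.
have ig1 D1 : measurable D1 -> mu.-integrable D1 (EFin \o g).
  by move=> mD1; exact: (integrableS measurableT mD1 (@subsetT _ _) ig).
rewrite Rintegral_itvB ?bnd_simp//; last exact: ig1.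
by apply: le_normr_Rintegral => //; exact: ig1.
Qed.

(** Lists of intervals are kept in descending order, so that non-overlapping is a
    condition on neighbours only and a list is extended to the right by consing. *)
Fixpoint chain a c (l : seq (R * R)) : Prop :=
  if l is p :: l' then [/\ p.1 <= p.2, p.2 <= c & chain a p.1 l'] else a <= c.

Lemma chain_le a c c' l : chain a c l -> c <= c' -> chain a c' l.
Proof.
case: l => [|p l] /=; first exact: le_trans.
by move=> [? pc ?] cc'; split => //; exact: le_trans cc'.
Qed.

Lemma chain_bound a c l : chain a c l -> a <= c.
Proof.
elim: l c => [|p l IH] c //= [p12 pc /IH ap].
exact: le_trans ap (le_trans p12 pc).
Qed.

Lemma chain_nth a c l i : chain a c l -> (i < size l)%N ->
  [/\ a <= (nth (0, 0) l i).1, (nth (0, 0) l i).1 <= (nth (0, 0) l i).2 &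
      (nth (0, 0) l i).2 <= c].
Proof.
elim: l c i => [|p l IH] c [|i] //= [p12 pc ch] il.
  by split => //; exact: chain_bound ch.
have [? ? H] := IH _ _ ch il; split => //.
exact: le_trans H (le_trans p12 pc).
Qed.

Lemma chain_disjoint a c l i j : chain a c l -> (i < j)%N -> (j < size l)%N ->
  (nth (0, 0) l j).2 <= (nth (0, 0) l i).1.
Proof.
elim: l c i j => [|p l IH] c [|i] [|j] //= [p12 pc ch].
  by move=> _ jl; have [] := chain_nth ch jl.
by move=> ij jl; exact: IH ch _ _.
Qed.

Lemma negligible_open_lt (A : set R) (d : R) : mu.-negligible A -> 0 < d ->
  exists U : set R, [/\ open U, A `<=` U & (mu U < d%:E)%E].
Proof.
move=> /negligible_outer_measure A0 d0.
have d2 : 0 < d / 2 by rewrite divr_gt0.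
have [U [oU AU]] := outer_measure_open_le A d2.
rewrite A0 add0e => Ud; exists U; split => //.
by apply: (le_lt_trans Ud); rewrite lte_fin ltr_pdivrMr// mulr2n ltr_pMr// ltrDl.
Qed.

(** Cousin's covering argument. Enclose the exceptional null set in an open set U
    of measure less than the d given by absolute continuity for e, and consider
    the points c such that |F c - F a| is at most e (c - a) plus the sum of the
    increments of F over finitely many non-overlapping intervals of U inside
    [a, c]. Their supremum is b: about a point where F has derivative 0, F is
    e-Lipschitz and the list of intervals is kept; about a point of U, one more
    interval is added. At b, absolute continuity bounds the sum by e. *)
Lemma abs_cont_derive0 F a b : a <= b -> abs_cont F a b ->
  {ae mu, forall x, a < x < b -> h^-1 * (F (x + h) - F x) @[h --> 0^'] --> 0} ->
  F a = F b.
Proof.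
move=> ab aF dF.
suff H (e : R) : 0 < e -> `|F b - F a| <= e * (b - a) + e.
  apply/eqP; rewrite eq_sym -subr_eq0 -normr_eq0 eq_le normr_ge0 andbT.
  apply/ler_addgt0Pr => e e0; rewrite add0r.
  have k0 : 0 < b - a + 1 by rewrite ltr_wpDl// subr_ge0.
  have := H (e / (b - a + 1)) (divr_gt0 e0 k0).
  have -> // : e / (b - a + 1) * (b - a) + e / (b - a + 1) = e.
  by field; rewrite gt_eqF.
move=> e0; have [d d0 Hd] := aF e e0.
pose bad : set R := ~` [set x | a < x < b ->
  h^-1 * (F (x + h) - F x) @[h --> 0^'] --> 0] `|` ([set a] `|` [set b]).
have nbad : mu.-negligible bad.
  apply: negligibleU; first exact: dF.
  by apply: negligibleU; apply/negligibleP => //; exact: lebesgue_measure_set1.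
have [U [oU badU Ud]] := negligible_open_lt nbad d0.
have mU : measurable U := open_measurable oU.
pose P c := exists l, [/\ chain a c l,
  ((\sum_(p <- l) (p.2 - p.1))%:E <= mu (U `&` `]a, c]))%E &
  `|F c - F a| <= e * (c - a) + \sum_(p <- l) `|F p.2 - F p.1|].
pose S := [set c | a <= c <= b /\ P c].
have Sa : S a.
  split; first by rewrite lexx.
  by exists [::]; split => //=; rewrite !big_nil ?subrr ?normr0 ?mulr0 ?addr0.
have hS : has_sup S by split; [exists a|exists b => c [/andP[]]].
have Pb : P b.
  pose m := sup S.
  have am : a <= m by apply: sup_upper_bound.
  have mb : m <= b by apply: ge_sup; [exists a|move=> c [/andP[]]].
  (* near m, either F is e-Lipschitz about m or the points lie in U *)
  have [k k0 Hk] : exists2 k : R, 0 < k &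
      (forall y, `|y - m| < k -> `|F y - F m| <= e * `|y - m|) \/
      (forall y, `|y - m| < k -> U y).
    have [/badU Um|/not_orP[/contrapT mgood /not_orP[ma mb']]] := pselect (bad m).
      have := open_nbhs_nbhs (conj oU Um); rewrite -nbhs_ballE => -[k /= k0 kU].
      exists k => //; right => y ym; apply: kU.
      by rewrite -ball_normE/= distrC.
    have /mgood : a < m < b.
      rewrite !lt_neqAle am mb !andbT; apply/andP; split; apply/eqP => //.
      by move=> E; apply: ma.
    move=> /cvgrPdist_le/(_ e e0).
    rewrite near_withinE => -[k /= k0 kH]; exists k => //; left => y ym.
    have [->|yn] := eqVneq y m; first by rewrite !subrr normr0 mulr0.
    have hn : y - m != 0 by rewrite subr_eq0.
    have := kH (y - m); rewrite /= sub0r normrN subrKC sub0r normrN => /(_ ym hn).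
    by rewrite normrM normfV mulrC ler_pdivrMr ?normr_gt0.
  have [c Sc cm] := sup_adherent k0 hS; have [/andP[ac cb] [l [ch ml Fl]]] := Sc.
  have cm' : c <= m by apply: sup_upper_bound.
  pose n := Num.min b (m + k / 2).
  have mn : m <= n by rewrite le_min mb lerDl divr_ge0// ltW.
  have nb : n <= b by rewrite ge_min lexx.
  have nk : n - m < k.
    rewrite ltrBlDl (@le_lt_trans _ _ (m + k / 2))//; first by rewrite ge_min lexx orbT.
    by rewrite ltrD2l ltr_pdivrMr// ltr_pMr// ltr1n.
  have cn : c <= n := le_trans cm' mn.
  have Pn : P n.
    case: Hk => Hk.
      exists l; split; first exact: chain_le ch cn.
        apply: (le_trans ml); apply: le_measure; rewrite ?inE.
        - exact: measurableI.
        - exact: measurableI.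
        - by apply: setIS; apply: subset_itvl; rewrite bnd_simp.
      have H1 : `|F n - F m| <= e * (n - m).
        by rewrite (le_trans (Hk n _)) ?ger0_norm ?subr_ge0.
      have H2 : `|F c - F m| <= e * (m - c).
        have cmk : `|c - m| < k.
          by rewrite distrC ger0_norm ?subr_ge0// ltrBlDl addrC -ltrBlDl.
        by rewrite (le_trans (Hk c cmk))// distrC ger0_norm ?subr_ge0.
      have -> : F n - F a = (F n - F m) + ((F m - F c) + (F c - F a)) by ring.
      apply: (le_trans (ler_normD _ _)).
      have H3 := ler_normD (F m - F c) (F c - F a).
      rewrite (distrC (F m)) in H3.
      have -> : e * (n - a) = e * (n - m) + e * (m - c) + e * (c - a) by ring.
      lra.
    exists ((c, n) :: l); split => /=.
    - by split.
    - rewrite big_cons /= EFinD.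
      have -> : U `&` `]a, n]%classic = (U `&` `]a, c]) `|` `]c, n].
        apply/seteqP; split => x /=; rewrite !in_itv/=.
          move=> [Ux /andP[ax xn]]; case: (leP x c) => xc; first by left; rewrite ax.
          by right; rewrite xn.
        move=> [[Ux /andP[ax xc]]|/andP[cx xn]].
          by split => //; rewrite ax (le_trans xc).
        split; last by rewrite (le_lt_trans ac cx).
        apply: Hk; rewrite ltr_norml; apply/andP; split; last first.
          by rewrite (le_lt_trans _ nk)// lerD2r.
        by rewrite ltrBrDl (lt_trans cm cx).
      rewrite measureU//; last 2 first.
      - exact: measurableI.
      - apply/seteqP; split => // x /=; rewrite !in_itv/= => -[[_ /andP[_ xc]] /andP[cx _]].
        by move: (le_lt_trans xc cx); rewrite ltxx.
      rewrite addeC leeD// [leRHS](@lebesgue_measure_itv R `]c, n]) /= lte_fin.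
      by case: ltgtP cn => // -> _; rewrite subrr.
    - rewrite big_cons/=.
      have -> : F n - F a = (F n - F c) + (F c - F a) by ring.
      apply: (le_trans (ler_normD _ _)); rewrite addrCA lerD2l (le_trans Fl)// lerD2r.
      by rewrite ler_wpM2l ?(ltW e0)// lerD2r.
  have Sn : S n by split => //; rewrite nb (le_trans ac cn).
  have nm : n <= m by exact: sup_upper_bound.
  suff <- : n = b by [].
  apply/eqP; rewrite eq_le nb/= leNgt; apply/negP => nltb.
  have : n = m + k / 2 by apply/min_idPr; move: nltb; rewrite /n gt_min ltxx/= => /ltW.
  move=> E; move: nm; rewrite E gerDl leNgt => /negP; apply.
  by rewrite divr_gt0.
have [l [ch ml Fl]] := Pb.
apply: (le_trans Fl); rewrite lerD2l; apply: ltW.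
rewrite (big_nth (0, 0)) big_mkord.
apply: Hd.
- by move=> i; exact: chain_nth ch (ltn_ord i).
- move=> i j; rewrite neq_ltn => /orP[ij|ji].
    by right; exact: chain_disjoint ch ij (ltn_ord j).
  by left; exact: chain_disjoint ch ji (ltn_ord i).
rewrite -lte_fin; apply: le_lt_trans Ud.
have := ml; rewrite (big_nth (0, 0)) big_mkord => /le_trans; apply.
by apply: le_measure; rewrite ?inE//; exact: measurableI.
Qed.

End absolute_continuity.

Section abs_cont_primitive.
Context (R : realType).
Notation mu := (@lebesgue_measure R).
Notation fk := (@frac_kernel R).
Implicit Types (F G W f g : R -> R) (a b s t x : R).

Lemma abs_cont_uniform F a b : abs_cont F a b -> forall e : R, 0 < e ->
  exists2 d : R, 0 < d & forall s t, a <= s -> s <= t -> t <= b -> t - s < d ->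
    `|F t - F s| < e.
Proof.
move=> aF e e0; have [d d0 H] := aF e e0; exists d => // s t as_ st tb tsd.
have := H 1%N (fun=> s) (fun=> t); rewrite !big_ord1; apply => //.
by move=> i j; rewrite !ord1 eqxx.
Qed.

Let prim g x := \int[mu]_(t in `]-oo, x]) g t.

Let prim_continuous g : mu.-integrable setT (EFin \o g) -> continuous (prim g).
Proof.
move=> ig x; apply/cvgrPdist_lt => e e0.
have [d d0 H] := abs_cont_uniform (@abs_cont_Rintegral R g (x - 1) (x + 1) ig) e0.
pose k := Num.min d 1; have k0 : 0 < k by rewrite lt_min d0 ltr01.
near=> y; have yx : `|x - y| < k by near: y; exact: cvgr_dist_lt.
move: yx; rewrite lt_min => /andP[yd y1].
have [xy|yx] := leP x y.
  rewrite distrC; apply: H => //; last by rewrite distrC ger0_norm ?subr_ge0 in yd.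
    by rewrite lerBlDr lerDl.
  by rewrite distrC ger0_norm ?subr_ge0// ltrBlDl in y1; exact: ltW.
apply: H; [|exact: ltW|by rewrite lerDl|by rewrite gtr0_norm ?subr_gt0 in yd].
by rewrite gtr0_norm ?subr_gt0// ltrBlDr -ltrBlDl in y1; exact: ltW.
Unshelve. all: by end_near. Qed.

Let prim_derive g : mu.-integrable setT (EFin \o g) ->
  {ae mu, forall x, h^-1 * (prim g (x + h) - prim g x) @[h --> 0^'] --> g x}.
Proof.
move=> ig.
have ig1 y : mu.-integrable `]-oo, y] (EFin \o g).
  exact: (@integrableS _ _ _ mu _ _ _ measurableT (measurable_itv _) (@subsetT _ _) ig).
have := FTC1Ny ig1 (open_integrable_locally openT ig).
apply: filterS; first exact: (ae_filter_ringOfSetsType mu).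
move=> x [dG <-].
rewrite derive1E; move: dG; rewrite /derivable/= => dG.
rewrite (_ : (fun h => _) = (fun h => h^-1 *:
  ((prim g \o shift x) (h *: (1 : R)) - prim g x))); first exact: dG.
by apply/funext => h; rewrite /= /GRing.scale/= mulr1 [h + x]addrC.
Qed.

Variables (W f : R -> R) (T w0 : R).
Hypothesis T_gt0 : 0 < T.
Hypothesis if_ : mu.-integrable setT (EFin \o f).
Hypothesis f0 : forall t, t <= 0 \/ T <= t -> f t = 0.
Hypothesis aW : forall s t, 0 < s -> t < T -> abs_cont W s t.
Hypothesis dW : {ae mu, forall x, 0 < x < T ->
  h^-1 * (W (x + h) - W x) @[h --> 0^'] --> - f x}.
Hypothesis WT : W s @[s --> T^'-] --> 0.
Hypothesis W0 : W s @[s --> 0^'+] --> w0.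

Let g x := - f x.
Let ig : mu.-integrable setT (EFin \o g).
Proof. by have := @integrableN _ _ _ mu _ _ if_. Qed.
Let G := prim g.

Let const s t : 0 < s -> s <= t -> t < T -> W s - G s = W t - G t.
Proof.
move=> s0 st tT; apply: (@abs_cont_derive0 _ (fun x => W x - G x)) => //.
  by apply: abs_contB; [exact: aW|exact: abs_cont_Rintegral].
move: dW (prim_derive ig); apply: filterS2.
  exact: (ae_filter_ringOfSetsType mu).
move=> x dWx dGx /andP[sx xt].
have xT : 0 < x < T by rewrite (lt_trans s0 sx) (lt_trans xt tT).
have := cvgB (dWx xT) dGx; rewrite subrr.
rewrite (_ : (fun h => h^-1 * (W (x + h) - G (x + h) - _)) = fun h =>
  h^-1 * (W (x + h) - W x) - h^-1 * (G (x + h) - G x)) => [H|]; first exact: H.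
by apply/funext => h /=; rewrite -mulrBr; congr (_ * _); rewrite /G; ring.
Qed.

Let T2 := T / 2.
Let T2_gt0 : 0 < T2. Proof. by rewrite divr_gt0. Qed.
Let T2_lt : T2 < T. Proof. by rewrite ltr_pdivrMr// ltr_pMr// ltr1n. Qed.
Let k := W T2 - G T2.

Let constE s : 0 < s < T -> W s = G s + k.
Proof.
move=> /andP[s0 sT]; have [sT2|sT2] := leP s T2.
  by rewrite /k -(const s0 sT2 T2_lt) subrKC.
by rewrite /k (const T2_gt0 (ltW sT2) sT) subrKC.
Qed.

Let G_0 : G 0 = 0.
Proof.
rewrite /G /prim (_ : \int[mu]_(t in _) _ = \int[mu]_(t in `]-oo, 0]) (cst 0 t)).
  by rewrite Rintegral_cst// mul0r.
by apply: eq_Rintegral => t; rewrite inE/= in_itv/= => t0; rewrite /g f0 ?oppr0//; left.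
Qed.

Let G_T : G T = - \int[mu]_t f t.
Proof.
rewrite -mulN1r -RintegralZl// /G /prim Rintegral_mkcond.
apply: eq_Rintegral => t _; rewrite patchE mulN1r; case: ifPn => // /negP.
rewrite inE/= in_itv/= => /negP; rewrite -ltNge => tT.
by rewrite f0 ?oppr0//; right; exact: ltW.
Qed.

Let kE : k = \int[mu]_t f t.
Proof.
have H : W s @[s --> T^'-] --> G T + k.
  apply: (@cvg_trans _ ((G s + k) @[s --> T^'-])); last first.
    apply: cvgD; last exact: cvg_cst.
    by apply: cvg_at_left_filter; exact: prim_continuous.
  apply: near_eq_cvg; near=> s; rewrite constE//; apply/andP; split => //.
have E : 0 = G T + k by apply: (cvg_unique _ WT H).
by apply/eqP; rewrite -subr_eq0 addrC -G_T -E.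
Unshelve. all: by end_near. Qed.

(** W differs by a constant from the primitive of - f, and the limit of W at T
    determines that constant. *)
Lemma abs_cont_initial_value : w0 = \int[mu]_t f t.
Proof.
have H : W s @[s --> 0^'+] --> G 0 + k.
  apply: (@cvg_trans _ ((G s + k) @[s --> 0^'+])); last first.
    apply: cvgD; last exact: cvg_cst.
    by apply: cvg_at_right_filter; exact: prim_continuous.
  apply: near_eq_cvg; near=> s; rewrite constE//; apply/andP; split => //.
have -> : w0 = G 0 + k by apply: (cvg_unique _ W0 H).
by rewrite G_0 add0r kE.
Unshelve. all: by end_near. Qed.

Lemma abs_cont_primitiveE s : 0 < s < T -> W s = \int[mu]_e (fk 1 (e - s) * f e).
Proof.
move=> sT; rewrite constE// kE.
have -> : \int[mu]_t f t = \int[mu]_(t in `]-oo, s]) f t + \int[mu]_(t in `]s, +oo[) f t.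
  rewrite -Rintegral_setU//; first by rewrite -itv_bndbnd_setU// set_itvNyy.
    by rewrite -itv_bndbnd_setU// set_itvNyy.
  apply/disj_set2P; rewrite -subset0 => x/=; rewrite !in_itv/= andbT => -[xs sx].
  by move: (le_lt_trans xs sx); rewrite ltxx.
have -> : G s = - \int[mu]_(t in `]-oo, s]) f t.
  rewrite -mulN1r -RintegralZl//.
    by apply: eq_Rintegral => t _; rewrite mulN1r.
  exact: (@integrableS _ _ _ mu _ _ _ measurableT (measurable_itv _) (@subsetT _ _) if_).
rewrite addrA addNr add0r Rintegral_mkcond; apply: eq_Rintegral => t _.
rewrite patchE; case: ifPn => [|/negP]; rewrite inE/= in_itv/= andbT.
  by move=> st; rewrite frac_kernel1 ?mul1r// subr_gt0.
by move=> /negP; rewrite -leNgt => ts; rewrite frac_kernel_eq0 ?mul0r// subr_le0.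
Qed.

End abs_cont_primitive.

(** * The space L^2(Omega) *)

Section Borel_rV.
Context (R : realType) (n : nat).

Let box (q : 'rV[rat]_n.+1 * nat) : set 'rV[R]_n.+1 :=
  [set x | forall i, `|x ord0 i - ratr (q.1 ord0 i)| < q.2.+1%:R^-1].

Let measurable_box q : measurable (box q).
Proof.
rewrite (_ : box q = \bigcap_(i : 'I_n.+1) (@rV_coord R n.+1 i @^-1`
    ball (ratr (q.1 ord0 i) : R) q.2.+1%:R^-1)); last first.
  apply/seteqP; split => [x Bx i _|x Bx i].
    by rewrite /= -ball_normE/= distrC; exact: Bx.
  by have := Bx i I; rewrite /= -ball_normE/= distrC.
apply: fin_bigcap_measurable => [|i _]; first exact: finite_finset.
rewrite -[X in measurable X]setTI; apply: measurable_rV_coord => //.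
exact: measurable_ball.
Qed.

(** An open set is the union of the boxes with rational centre and radius
    1 / (k + 1) that it contains. *)
Lemma open_measurable_rV (A : set 'rV[R]_n.+1) : open A -> measurable A.
Proof.
move=> oA.
rewrite (_ : A = \bigcup_q (if pselect (box q `<=` A) then box q else set0)).
  apply: countable_bigcupT_measurable; first exact: countableP.
  by move=> q; case: pselect => ?; [exact: measurable_box|exact: measurable0].
apply/seteqP; split => [x Ax|x [q _]]; last first.
  by case: pselect => //; apply.
have := open_nbhs_nbhs (conj oA Ax); rewrite -nbhs_ballE => -[e /= e0 eA].
pose k := Num.truncn (2 / e).
have [d [d0 de dE]] : exists d : R, [/\ 0 < d, 2 * d < e & k.+1%:R^-1 = d].
  exists k.+1%:R^-1; split => //.
  by rewrite ltr_pdivrMr// mulrC -ltr_pdivrMr//; exact: truncnS_gt.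
have qx i : {q : rat | `|x ord0 i - ratr q| < d}.
  apply: cid; have : x ord0 i - d < x ord0 i + d by lra.
  move=> /rat_in_itvoo[q]; rewrite in_itv/= => /andP[q1 q2]; exists q.
  by rewrite ltr_norml; apply/andP; split; lra.
pose q : 'rV[rat]_n.+1 := \row_i sval (qx i).
have bx : box (q, k) x by move=> i /=; rewrite mxE dE; exact: (svalP (qx i)).
exists (q, k) => //; case: pselect => // -[] y By; apply: eA; split => // i j.
rewrite ord1 -ball_normE/=.
have := By j; have := bx j; rewrite /= dE => H1 H2.
have -> : x ord0 j - y ord0 j = (x ord0 j - ratr (q ord0 j)) - (y ord0 j - ratr (q ord0 j)) by ring.
by rewrite (le_lt_trans (ler_normB _ _))//; lra.
Qed.

End Borel_rV.

Section L2_theory.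
Context (R : realType) (n : nat) (Omega : set 'rV[R]_n).
Hypothesis mO : measurable Omega.
Notation leb := (lebesgue_rV R n).
Notation L2 := (L2 Omega).
Notation dot := (dotL2 Omega).
Notation norm := (normL2 Omega).
Implicit Types u v w : 'rV[R]_n -> R.

Lemma L2_sqr_integrable u : L2 u -> leb.-integrable Omega (fun x => (u x ^+ 2)%:E).
Proof.
move=> [mu_ iu]; apply/integrableP; split.
  by apply/measurable_EFinP; exact: measurable_funX.
by under eq_integral do rewrite gee0_abs ?lee_fin ?sqr_ge0//.
Qed.

Lemma L2_mul_integrable u v : L2 u -> L2 v ->
  leb.-integrable Omega (EFin \o (fun x => u x * v x)).
Proof.
move=> Lu Lv.
have isum := @integrableD _ _ _ leb _ mO _ _ (L2_sqr_integrable Lu) (L2_sqr_integrable Lv).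
apply: (@le_integrable _ _ _ leb _ mO _ _ _ _ isum).
  by apply/measurable_EFinP; apply: measurable_funM; [case: Lu|case: Lv].
move=> x _ /=; rewrite lee_fin normrM [leRHS]ger0_norm ?addr_ge0 ?sqr_ge0//.
rewrite -(real_normK (num_real (u x))) -(real_normK (num_real (v x))).
by have := sqr_ge0 (`|u x| - `|v x|); have := normr_ge0 (u x); have := normr_ge0 (v x); nra.
Qed.

Lemma L2Z (k : R) u : L2 u -> L2 (fun x => k * u x).
Proof.
move=> Lu; split; first by apply: measurable_funM => //; case: Lu.
have := integrableZl mO (k ^+ 2) (L2_sqr_integrable Lu).
move=> /(integrable_lty mO); congr (_ < _)%E; apply: eq_integral => x _.
by rewrite -EFinM exprMn.
Qed.

Lemma L2D u v : L2 u -> L2 v -> L2 (fun x => u x + v x).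
Proof.
move=> Lu Lv; have m : measurable_fun Omega (fun x => u x + v x).
  by apply: measurable_funD; [case: Lu|case: Lv].
split => //.
have isum := @integrableD _ _ _ leb _ mO _ _ (L2_sqr_integrable Lu) (L2_sqr_integrable Lv).
have i2 := integrableZl mO 2 isum.
apply: (le_lt_trans _ (integrable_lty mO i2)).
apply: ge0_le_integral => //.
- by move=> x _; rewrite lee_fin sqr_ge0.
- by apply/measurable_EFinP; exact: measurable_funX.
- exact: measurable_int i2.
- move=> x _; rewrite /= lee_fin; have := sqr_ge0 (u x - v x); nra.
Qed.

Lemma L2B u v : L2 u -> L2 v -> L2 (fun x => u x - v x).
Proof.
move=> Lu Lv; rewrite (_ : (fun x => _) = fun x => u x + -1 * v x).
  by apply: L2D => //; exact: L2Z.
by apply/funext => x; rewrite mulN1r.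
Qed.

Lemma dotL2C u v : dot u v = dot v u.
Proof. by apply: eq_Rintegral => x _; rewrite mulrC. Qed.

Lemma dotL2Dl u v w : L2 u -> L2 v -> L2 w ->
  dot (fun x => u x + v x) w = dot u w + dot v w.
Proof.
move=> Lu Lv Lw; rewrite /dotL2 -RintegralD//; try exact: L2_mul_integrable.
by apply: eq_Rintegral => x _; rewrite mulrDl.
Qed.

Lemma dotL2Bl u v w : L2 u -> L2 v -> L2 w ->
  dot (fun x => u x - v x) w = dot u w - dot v w.
Proof.
move=> Lu Lv Lw; rewrite /dotL2 -RintegralB//; try exact: L2_mul_integrable.
by apply: eq_Rintegral => x _; rewrite mulrBl.
Qed.

Lemma dotL2Zl (k : R) u w : L2 u -> L2 w ->
  dot (fun x => k * u x) w = k * dot u w.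
Proof.
move=> Lu Lw; rewrite /dotL2 -RintegralZl//; last exact: L2_mul_integrable.
by apply: eq_Rintegral => x _; rewrite mulrA.
Qed.

Lemma dotL2_ge0 u : 0 <= dot u u.
Proof. by apply: Rintegral_ge0 => x _; rewrite -expr2 sqr_ge0. Qed.

Lemma normL2_sqr u : norm u ^+ 2 = dot u u.
Proof. by rewrite sqr_sqrtr// dotL2_ge0. Qed.

Lemma dotL2_sqrB (t : R) u v : L2 u -> L2 v ->
  dot (fun x => u x - t * v x) (fun x => u x - t * v x) =
  dot u u - 2 * t * dot u v + t ^+ 2 * dot v v.
Proof.
move=> Lu Lv; have Lt := L2Z t Lv; have Lut := L2B Lu Lt.
rewrite dotL2Bl// dotL2Zl// ![dot _ (fun x => _ - _)]dotL2C !dotL2Bl// !dotL2Zl//.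
by rewrite (dotL2C v u); ring.
Qed.

(** The norm of u - t v is nonnegative: take t = <u, v> / <v, v> when the
    denominator is nonzero, and a t making the affine expression -1 otherwise. *)
Lemma dotL2_cauchy_schwarz u v : L2 u -> L2 v -> `|dot u v| <= norm u * norm v.
Proof.
move=> Lu Lv.
have H t : 0 <= dot u u - 2 * t * dot u v + t ^+ 2 * dot v v.
  by rewrite -dotL2_sqrB// dotL2_ge0.
rewrite -ler_sqr ?nnegrE ?mulr_ge0 ?sqrtr_ge0// exprMn !normL2_sqr real_normK ?num_real//.
move: (dotL2_ge0 u) (dotL2_ge0 v) H; move: (dot u u) (dot u v) (dot v v).
move=> a b c a0; rewrite le_eqVlt => /predU1P[<-|c0] H.
  have [->|b0] := eqVneq b 0; first by rewrite expr0n mulr0.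
  have := H ((a + 1) / (2 * b)).
  have -> : 2 * ((a + 1) / (2 * b)) * b = a + 1 by field.
  by rewrite mulr0; lra.
have := H (b / c).
have -> : a - 2 * (b / c) * b + (b / c) ^+ 2 * c = (a * c - b ^+ 2) / c.
  by field; rewrite gt_eqF.
by rewrite pmulr_lge0 ?invr_gt0// subr_ge0.
Qed.

Lemma normL2_eq0 u : L2 u -> norm u = 0 -> ae_eq leb Omega u (cst 0).
Proof.
move=> Lu u0; have i2 := L2_sqr_integrable Lu.
have D0 : dot u u = 0 by rewrite -normL2_sqr u0 expr0n.
have E : (\int[leb]_(x in Omega) `|(u x ^+ 2)%:E| = 0)%E.
  under eq_integral do rewrite gee0_abs ?lee_fin ?sqr_ge0//.
  rewrite -[LHS]fineK; last exact: integrable_fin_num.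
  by congr EFin; rewrite -[RHS]D0.
have /(ae_eq_integral_abs leb mO) := E.
move=> /(_ (measurable_int _ i2)).
apply: filterS.
move=> x H Ox; have /= [] := H Ox => /eqP.
by rewrite sqrf_eq0 => /eqP.
Qed.

Lemma eqL2_norm u v : L2 u -> L2 v -> norm (u \- v) = 0 -> eqL2 Omega u v.
Proof.
move=> Lu Lv H; have := normL2_eq0 (L2B Lu Lv) H.
apply: filterS.
by move=> x H' /H' /eqP; rewrite subr_eq0 => /eqP.
Qed.

Lemma normL2_const_cvg u l : norm u @[_ --> \oo] --> (l : R) -> norm u = l.
Proof. by move=> H; apply: (cvg_unique _ _ H) => //; exact: cvg_cst. Qed.

End L2_theory.

(** * Functions with values in a Hilbert space *)

Section Hilbert_valued_functions.
Context (R : realType) (O : normedModType R) (dot : O -> O -> R).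
Hypothesis dotP : hilbert_product dot.
Notation mu := (@lebesgue_measure R).

Lemma hilbert_dotZl (k : R) x y : dot (k *: x) y = k * dot x y.
Proof.
have [_ L _] := dotP.
have d0 w : dot 0 w = 0.
  have := L 1 0 0 w; rewrite scaler0 addr0 mul1r => /eqP.
  by rewrite -subr_eq0 opprD addNKr oppr_eq0 => /eqP.
by rewrite -[k *: x]addr0 L d0 addr0.
Qed.

Lemma hilbert_normD x y : `|x + y| ^+ 2 = `|x| ^+ 2 + 2 * dot x y + `|y| ^+ 2.
Proof.
have [S L N] := dotP; rewrite -!N -{1}[x]scale1r L (S x (x + y)) (S y (x + y)).
by rewrite -{1 3}[x]scale1r !L (S y x) !mul1r; ring.
Qed.

Lemma hilbert_dot_polar x y : dot x y = (`|x + y| ^+ 2 - `|x| ^+ 2 - `|y| ^+ 2) / 2.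
Proof. by rewrite hilbert_normD; field. Qed.

Lemma hilbert_dot_le x y : `|dot x y| <= `|x| ^+ 2 + `|y| ^+ 2.
Proof.
have H u v : - dot u v <= `|u| ^+ 2 + `|v| ^+ 2.
  have := sqr_ge0 `|u + v|; rewrite hilbert_normD.
  by have := sqr_ge0 `|u|; have := sqr_ge0 `|v|; lra.
rewrite ler_norml; apply/andP; split; first by have := H x y; lra.
have := H (- x) y; rewrite normrN -(scaleN1r x) hilbert_dotZl; lra.
Qed.

Lemma simple_functions_measurable (h : O -> O -> R) (s s' : R -> O) :
  simple_function s -> simple_function s' ->
  measurable_fun [set: measurableTypeR R] (fun t => h (s t) (s' t)).
Proof.
move=> [fs ms] [fs' ms'] _ Y mY; rewrite setTI.
rewrite (_ : _ @^-1` Y = \bigcup_(o in range s) \bigcup_(o' in range s')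
    (if `[< Y (h o o') >] then (s @^-1` [set o]) `&` (s' @^-1` [set o']) else set0)).
  apply: fin_bigcup_measurable => // o _; apply: fin_bigcup_measurable => // o' _.
  by case: ifPn => // _; apply: measurableI; [exact: ms|exact: ms'].
apply/seteqP; split => [t /= Yt|t [c _ [c' _]]].
  by exists (s t); [exists t|exists (s' t); [exists t|rewrite asboolT]].
by case: asboolP => // Y' [] /= -> ->.
Qed.

(** For simple functions the scalar product takes finitely many values; the
    polarization identity makes it continuous in the norm. *)
Lemma strongly_measurable_dot (D : set R) (f g : R -> O) : measurable D ->
  strongly_measurable D f -> strongly_measurable D g ->
  measurable_fun D (fun t => dot (f t) (g t)).
Proof.
move=> mD [s [ss sf]] [s' [ss' sg]].
apply: (@measurable_fun_cvg _ _ _ _ (fun k t => dot (s k t) (s' k t))).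
  by move=> k; apply: measurable_funTS; exact: simple_functions_measurable.
move=> t Dt; rewrite hilbert_dot_polar.
under eq_fun do rewrite hilbert_dot_polar.
have H1 : `|s k t + s' k t| @[k --> \oo] --> `|f t + g t|.
  exact: cvg_norm (cvgD (sf t Dt) (sg t Dt)).
have H2 : `|s k t| @[k --> \oo] --> `|f t| by exact: cvg_norm (sf t Dt).
have H3 : `|s' k t| @[k --> \oo] --> `|g t| by exact: cvg_norm (sg t Dt).
have sq (u : nat -> R) (l : R) : u k @[k --> \oo] --> l -> u k ^+ 2 @[k --> \oo] --> l ^+ 2.
  by move=> H; exact: (cvgM H H).
apply: cvgMl; apply: cvgB; last exact: sq H3.
by apply: cvgB; [exact: sq H1|exact: sq H2].
Qed.

Lemma strongly_measurable_cst (D : set R) (o : O) : strongly_measurable D (fun=> o).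
Proof.
exists (fun _ _ => o); split; last by move=> t _; exact: cvg_cst.
move=> _; split.
  by apply: (sub_finite_set _ (finite_set1 o)) => _ [t _ <-].
move=> o'; have [->|oo'] := eqVneq o' o.
  by rewrite (_ : _ @^-1` _ = setT)//; apply/seteqP; split.
rewrite (_ : _ @^-1` _ = set0)//; apply/seteqP; split => // t /= /esym /eqP.
by rewrite (negbTE oo').
Qed.

Lemma L2T_dot_integrable (T : R) (o : O) (z : R -> O) : L2T T z ->
  mu.-integrable `]0, T[ (EFin \o (fun t => dot o (z t))).
Proof.
move=> [mz iz].
have mdot : measurable_fun `]0, T[ (fun t => dot o (z t)).
  apply: strongly_measurable_dot => //; exact: strongly_measurable_cst.
have mz2 : measurable_fun `]0, T[ (fun t => `|z t| ^+ 2).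
  rewrite (_ : (fun t => _) = (fun t => dot (z t) (z t))).
    exact: strongly_measurable_dot.
  by apply/funext => t; case: dotP.
have iz2 : mu.-integrable `]0, T[ (EFin \o (fun t => `|z t| ^+ 2)).
  apply/integrableP; split; first exact/measurable_EFinP.
  by under eq_integral do rewrite /= ger0_norm ?exprn_ge0//.
have io : mu.-integrable `]0, T[ (EFin \o (fun t : R => `|o| ^+ 2)).
  apply/integrableP; split; first exact/measurable_EFinP.
  rewrite -[X in (X < _)%E]/(\int[mu]_(t in `]0%R, T[) cst (Num.norm (Num.norm o ^+ 2))%:E t)%E.
  rewrite integral_cst//= lebesgue_measure_itv/= lte_fin.
  by case: ifP => _; rewrite ?mule0 ?ltry// -EFinB -EFinM ltry.
apply: (@le_normr_integrable _ _ _ (fun t => `|o| ^+ 2 + `|z t| ^+ 2)) => //.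
  exact: (@integrableD _ _ _ mu _ (measurable_itv _) _ _ io iz2).
move=> t _; rewrite [leRHS]ger0_norm ?addr_ge0 ?exprn_ge0//.
exact: hilbert_dot_le.
Qed.

End Hilbert_valued_functions.

(** * Testing a function of time and space against a function of space *)

Section space_time.
Context (R : realType) (n : nat) (Omega : set 'rV[R]_n).
Hypothesis mO : measurable Omega.
Notation mu := (@lebesgue_measure R).
Notation leb := (lebesgue_rV R n).
Notation fk := (@frac_kernel R).
Variables (T : R) (r : R -> 'rV[R]_n -> R) (p : 'rV[R]_n -> R).
Hypothesis T_gt0 : 0 < T.
Hypothesis Lp : L2 Omega p.
Hypothesis mr : measurable_fun (`]0, T[ `*` Omega)
  (fun q : measurableTypeR R * 'rV[R]_n => r q.1 q.2).
Hypothesis aL2 : {ae mu, forall s, `]0, T[%classic s -> L2 Omega (r s)}.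
Hypothesis iL1 : (\int[mu]_(s in `]0%R, T[) (normL2 Omega (r s))%:E < +oo)%E.

Let D : set (measurableTypeR R * 'rV[R]_n) := `]0, T[%classic `*` Omega.

Let mD : measurable D. Proof. by apply: measurableX. Qed.

Let F : measurableTypeR R * 'rV[R]_n -> R := (fun q => r q.1 q.2 * p q.2) \_ D.

Let mF : measurable_fun setT F.
Proof.
apply: (measurable_restrictT
  (fun q : measurableTypeR R * 'rV[R]_n => r q.1 q.2 * p q.2) mD).1.
apply: (@measurable_funM _ _ R D (fun q => r q.1 q.2) (fun q => p q.2)) => //.
apply: (@measurable_comp _ _ _ _ _ _ Omega p) => //; last first.
  by apply: measurable_funTS; exact: measurable_snd.
- by case: Lp.
- by move=> _ [[s y] [_ Oy] <-].
Qed.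

Let F_in s y : `]0, T[%classic s -> F (s, y) = ((fun y => r s y * p y) \_ Omega) y.
Proof.
move=> sT; rewrite /F !patchE; congr (if _ then _ else _).
by apply/idP/idP; rewrite !inE/= => // -[].
Qed.

Let F_out s y : ~ `]0, T[%classic s -> F (s, y) = 0.
Proof. by move=> sT; rewrite /F patchE memNset// => -[]. Qed.

Let out_itv s : s <= 0 \/ T <= s -> ~ `]0, T[%classic s.
Proof. by rewrite /= in_itv/= => -[] H /andP[s0 s1]; move: H; rewrite leNgt ?s0 ?s1. Qed.

(** The coefficient <r(s), p> for s in ]0, T[, and 0 elsewhere: the product r p is
    cut off to a function on the whole space-time, to which Fubini applies. *)
Definition time_coef (s : R) : R := \int[leb]_y F (s, y).
Notation rho := time_coef.

Lemma time_coefE s : 0 < s < T -> rho s = dotL2 Omega (r s) p.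
Proof.
move=> sT; rewrite /rho /dotL2 [RHS]Rintegral_mkcond.
by apply: eq_Rintegral => y _; rewrite F_in//= in_itv.
Qed.

Lemma time_coef_out s : s <= 0 \/ T <= s -> rho s = 0.
Proof.
move=> /out_itv sT.
rewrite /rho (_ : \int[leb]_y _ = \int[leb]_y (cst 0 y)).
  by rewrite Rintegral_cst// mul0r.
by apply: eq_Rintegral => y _; exact: F_out.
Qed.

Let normF (s : R) : R := \int[leb]_y `|F (s, y)|.

Let L2_norm u : L2 Omega u -> L2 Omega (fun y => `|u y|).
Proof.
move=> [mu_ iu]; split; first exact: measurableT_comp.
by under eq_integral do rewrite real_normK ?num_real//.
Qed.

Let normL2_norm u : normL2 Omega (fun y => `|u y|) = normL2 Omega u.
Proof.
congr Num.sqrt; apply: eq_Rintegral => y _.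
by rewrite -!expr2 real_normK ?num_real.
Qed.

Let int_normF_le s : `]0, T[%classic s -> L2 Omega (r s) ->
  (\int[leb]_y `|(F (s, y))%:E| <= (normL2 Omega (r s) * normL2 Omega p)%:E)%E.
Proof.
move=> sT Ls.
have iL := L2_mul_integrable mO (L2_norm Ls) (L2_norm Lp).
have -> : (\int[leb]_y `|(F (s, y))%:E| = (dotL2 Omega (fun y => `|r s y|) (fun y => `|p y|))%:E)%E.
  rewrite /dotL2 fineK; last exact: integrable_fin_num iL.
  rewrite [RHS]integral_mkcond; apply: eq_integral => y _; rewrite F_in//.
  by rewrite !patchE; case: ifP => _ /=; rewrite ?normr0 ?normrM.
have := dotL2_cauchy_schwarz mO (L2_norm Ls) (L2_norm Lp).
by rewrite !normL2_norm lee_fin; exact: le_trans (ler_norm _).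
Qed.

(* s |-> |r(s)|, in a form whose measurability follows from Tonelli *)
Let N s := Num.sqrt (\int[leb]_y ((fun q => r q.1 q.2 * r q.1 q.2) \_ D) (s, y)).

Let NE s : `]0, T[%classic s -> N s = normL2 Omega (r s).
Proof.
move=> sT; rewrite /N /normL2 /dotL2 [in RHS]Rintegral_mkcond; congr Num.sqrt.
apply: eq_Rintegral => y _; rewrite !patchE; congr (if _ then _ else _).
by apply/idP/idP; rewrite !inE/= => // -[].
Qed.

Let mN : measurable_fun setT N.
Proof.
apply: measurableT_comp; first exact: (continuous_measurable_fun (@sqrt_continuous R)).
apply: measurable_fun_Rintegral_section.
apply: (measurable_restrictT
  (fun q : measurableTypeR R * 'rV[R]_n => r q.1 q.2 * r q.1 q.2) mD).1.
by apply: (@measurable_funM _ _ R D (fun q => r q.1 q.2) (fun q => r q.1 q.2)).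
Qed.

Let integrable_F : (mu \x leb)%E.-integrable setT (EFin \o F).
Proof.
have mEF : measurable_fun setT (EFin \o F) by exact/measurable_EFinP.
apply/integrable12ltyP => //.
have mS : measurable_fun setT (fun s => \int[leb]_y `|(F (s, y))%:E|)%E.
  apply: (@measurable_fun_integral_section _ _ _ _ _ _ (fun q => `|(F q)%:E|%E)).
  exact: measurableT_comp.
have -> : (\int[mu]_s \int[leb]_y `|(F (s, y))%:E| =
    \int[mu]_(s in `]0%R, T[) \int[leb]_y `|(F (s, y))%:E|)%E.
  rewrite [RHS]integral_mkcond; apply: eq_integral => s _.
  rewrite patchE; case: ifPn => // /negP; rewrite inE => sT.
  by rewrite integral0_eq// => y _; rewrite F_out//= normr0.
apply: (@le_lt_trans _ _ (\int[mu]_(s in `]0%R, T[) ((normL2 Omega p)%:E * (N s)%:E))%E).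
  apply: ae_ge0_le_integral => //.
  - by move=> s _; apply: integral_ge0.
  - exact: measurable_funTS.
  - by move=> s _; rewrite -EFinM lee_fin mulr_ge0// sqrtr_ge0.
  - apply/measurable_EFinP; apply: measurable_funTS; exact: measurable_funM.
  - move: aL2; apply: filterS; first exact: (ae_filter_ringOfSetsType mu).
    move=> s Ls sT; rewrite NE// -EFinM mulrC; apply: int_normF_le => //.
    exact: Ls.
rewrite ge0_integralZl//.
- under eq_integral => s; first by rewrite inE => sT; rewrite NE//; over.
  by rewrite lte_mul_pinfty ?lee_fin ?sqrtr_ge0.
- by apply/measurable_EFinP; exact: measurable_funTS.
- by move=> s _; rewrite lee_fin sqrtr_ge0.
- by rewrite lee_fin sqrtr_ge0.
Qed.

Let fine_integrable (g : R -> \bar R) : mu.-integrable setT g ->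
  mu.-integrable setT (EFin \o (fine \o g)).
Proof.
move=> ig; have mg := measurable_int _ ig.
apply: (@le_integrable _ _ _ mu _ measurableT _ _ _ _ ig) => //.
  by apply/measurable_EFinP; exact: measurableT_comp.
by move=> s _ /=; case: (g s) => [x| |] //=; rewrite ?normr0 ?leey.
Qed.

Lemma time_coef_integrable : mu.-integrable setT (EFin \o rho).
Proof. exact: (fine_integrable (integrable_fubini_F integrable_F)). Qed.

Let normF_integrable : mu.-integrable setT (EFin \o normF).
Proof.
have iN : (mu \x leb)%E.-integrable setT (EFin \o (fun q => `|F q|)).
  exact: (integrable_norm integrable_F).
exact: (fine_integrable (integrable_fubini_F iN)).
Qed.

(** The scalar product with p commutes with the fractional integral for almost
    every s, namely those where the fractional integral of the norm
    int |r(e, y) p(y)| dy converges. This convergence is Tonelli applied to the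
    kernel k_1 * k_b = k_(1+b). *)
Lemma time_coef_RL_integral (b : R) : 0 < b ->
  (forall s, 0 < s < T -> RL_integrable Omega T b r s /\
     L2 Omega (RL_integral T b r s)) ->
  {ae mu, forall s, 0 < s < T ->
    dotL2 Omega (RL_integral T b r s) p = \int[mu]_e (fk b (e - s) * rho e)}.
Proof.
move=> b0 HRL.
have mnF : measurable_fun [set: R] normF.
  by apply/measurable_EFinP; exact: measurable_int normF_integrable.
have normF_out t : t <= 0 \/ T <= t -> normF t = 0.
  move=> /out_itv tT; rewrite /normF (_ : \int[leb]_y _ = \int[leb]_y (cst 0 y)).
    by rewrite Rintegral_cst// mul0r.
  by apply: eq_Rintegral => y _; rewrite F_out// normr0.
have ikn : mu.-integrable setT (EFin \o (fun e => fk (1 + b) e * normF e)).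
  apply: (@bounded_mul_integrable _ (T `^ b / Gamma (1 + b))) => //.
    exact: measurable_frac_kernel.
  move=> t _; have [t0|t0] := leP t 0; first by right; rewrite normF_out//; left.
  have [tT|tT] := leP T t; first by right; rewrite normF_out//; right.
  left; rewrite ger0_norm ?frac_kernel_ge0// frac_kernelE// addrAC subrr add0r.
  rewrite ler_wpM2r ?invr_ge0 ?Gamma_ge0//.
  by apply: ge0_ler_powR; rewrite ?nnegrE// ltW.
have := @frac_kernel_ae_integrable R 1 b normF ltr01 b0 mnF ikn.
apply: filterS; first exact: (ae_filter_ringOfSetsType mu).
move=> s is_ /andP[s0 sT]; have {is_} := is_ s0 => is_.
have [|RLs Lw] := HRL s; first by rewrite s0.
pose H (q : measurableTypeR R * 'rV[R]_n) : R := fk b (q.1 - s) * F q.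
have mH : measurable_fun setT H.
  apply: measurable_funM => //.
  exact: measurableT_comp (measurable_frac_kernel_shift b s) measurable_fst.
have aeF := ae_integrable1 integrable_F.
have iH : (mu \x leb)%E.-integrable setT (EFin \o H).
  have mEH : measurable_fun setT (EFin \o H) by exact/measurable_EFinP.
  apply/integrable12ltyP => //.
  have /integrableP[_] := is_; apply: le_lt_trans.
  apply: ae_ge0_le_integral => //.
  - by move=> e _; exact: integral_ge0.
  - apply: (@measurable_fun_integral_section _ _ _ _ _ _ (fun q => `|(H q)%:E|%E)).
    exact: measurableT_comp.
  - apply: measurableT_comp => //; exact: measurable_int is_.
  - move: aeF; apply: filterS => e iFe _.
    have iFn : leb.-integrable setT (EFin \o (fun y => `|F (e, y)|)) := integrable_norm iFe.
    rewrite /H; under eq_integral do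
      rewrite /= normrM (ger0_norm (frac_kernel_ge0 _ _)) EFinM.
    rewrite integralZl//= -[X in (_ * X <= _)%E]fineK; last exact: integrable_fin_num iFn.
    rewrite -EFinM lee_fin; exact: ler_norm.
congr fine.
transitivity (\int[leb]_y \int[mu]_e (H (e, y))%:E)%E.
  rewrite [LHS]integral_mkcond; apply: ae_eq_integral => //.
  - rewrite restrict_EFin; apply/measurable_EFinP.
    apply: (measurable_restrictT (fun y => RL_integral T b r s y * p y) mO).1.
    by apply: measurable_funM; [case: Lw|case: Lp].
  - exact: (measurable_fubini_G iH).
  case: RLs => [b00|]; first by move: b0; rewrite b00 ltxx.
  apply: filterS => y iy _; rewrite patchE; case: ifPn => [|/negP]; rewrite inE => Oy; last first.
    rewrite integral0_eq// => e _; rewrite /H /F patchE memNset ?mulr0//.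
    by move=> [].
  have {}iy := iy Oy.
  pose k e := RL_kernel b s e * r e y.
  have ik : mu.-integrable `[s, T] (EFin \o k) by exact: iy.
  have ik1 : mu.-integrable `]s, T] (EFin \o k).
    by apply: (@integrableS _ _ _ mu _ _ _ _ _ _ ik) => //; apply: subset_itv; rewrite bnd_simp.
  have ik2 : mu.-integrable `]s, T[ (EFin \o k).
    by apply: (@integrableS _ _ _ mu _ _ _ _ _ _ ik1) => //; apply: subset_itv; rewrite bnd_simp.
  have -> : RL_integral T b r s y = \int[mu]_(e in `]s, T[) k e.
    rewrite /RL_integral gt_eqF// Rintegral_itv_bndo_bndc// Rintegral_itv_obnd_cbnd//.
  have HE : forall e, H (e, y) = (fun e => k e * p y) \_ `]s, T[ e.
    move=> e; rewrite /H patchE; case: ifPn => [|/negP]; rewrite inE/= in_itv/=.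
      move=> /andP[se eT]; rewrite /F patchE mem_set; last first.
        by split => //=; rewrite in_itv/= eT (lt_trans s0 se).
      by rewrite frac_kernelE ?subr_gt0//= /k /RL_kernel mulrA.
    move=> /negP; rewrite negb_and -!leNgt => /orP[es|Te].
      by rewrite frac_kernel_eq0 ?mul0r// subr_le0.
    rewrite F_out ?mulr0//= in_itv/= => /andP[_].
    by rewrite ltNge Te.
  have -> : (\int[mu]_e (H (e, y))%:E = \int[mu]_(e in `]s, T[) ((k e)%:E * (p y)%:E))%E.
    rewrite [RHS]integral_mkcond; apply: eq_integral => e _.
    by rewrite HE !patchE; case: ifP => // _; rewrite EFinM.
  rewrite integralZr// EFinM; congr (_ * _)%E.
  by rewrite fineK//; exact: integrable_fin_num ik2.
rewrite -(Fubini iH).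
apply: ae_eq_integral => //.
- exact: (measurable_fubini_F iH).
- apply/measurable_EFinP; apply: measurable_funM.
    exact: measurable_frac_kernel_shift.
  by apply/measurable_EFinP; exact: measurable_int time_coef_integrable.
move: aeF; apply: filterS => e iFe _; rewrite /H; under eq_integral do rewrite /= EFinM.
rewrite integralZl// EFinM; congr (_ * _)%E.
by rewrite fineK//; exact: integrable_fin_num iFe.
Qed.

End space_time.

(** * The observability operator on eigenfunctions *)

Section eigenfunctions.
Context (R : realType) (n : nat) (Omega : set 'rV[R]_n) (mO : measurable Omega).
Context (lam : nat -> R) (mult : nat -> nat)
  (phi : forall i : nat, 'I_(mult i) -> 'rV[R]_n -> R).
Hypothesis phi_orthonormal : orthonormal_basis Omega phi.

Let phi_L2 i (j : 'I_(mult i)) : L2 Omega (phi j).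
Proof. by case: phi_orthonormal => + _; apply. Qed.

Lemma eigenprojection_eigenfunction i (j : 'I_(mult i)) k x :
  eigenprojection Omega phi k (phi j) x = (i == k)%:R * phi j x.
Proof.
have [_ [ortho _]] := phi_orthonormal; rewrite /eigenprojection.
have [ik|ik] := eqVneq i k.
  subst k; rewrite mul1r (bigD1 j)//= ortho !eqxx mul1r big1 ?addr0// => j' j'j.
  by rewrite ortho eqxx/= eq_sym (negbTE j'j : (_ == _ :> nat) = false) mul0r.
by rewrite mul0r big1// => j' _; rewrite ortho (negbTE ik) mul0r.
Qed.

(** The partial sums defining S_alpha(t) phi are constant beyond the index of the
    eigenvalue. *)
Lemma opS_eigenfunction (alpha t : R) i (j : 'I_(mult i)) u :
  opS Omega lam phi alpha t (phi j) u ->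
  eqL2 Omega (fun x => mittag_leffler alpha (- lam i * t `^ alpha) * phi j x) u.
Proof.
move=> [_ Lu H]; set E := mittag_leffler _ _.
have LE : L2 Omega (fun x => E * phi j x) by exact: L2Z.
apply: eqL2_norm => //.
have C : normL2 Omega ((fun x => E * phi j x) \- u) @[N --> \oo] --> (0 : R).
  apply: cvg_trans H; apply: near_eq_cvg; near=> N.
  congr (normL2 Omega (_ \- u)); apply/funext => x.
  have iN : (i < N)%N by near: N; exact: nbhs_infty_gt.
  rewrite (bigD1 (Ordinal iN))//= eigenprojection_eigenfunction eqxx mul1r.
  rewrite big1 ?addr0// => k ki; rewrite eigenprojection_eigenfunction.
  by rewrite eq_sym (negbTE ki : (_ == _ :> nat) = false) mul0r mulr0.
exact: normL2_const_cvg C.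
Unshelve. all: by end_near. Qed.

Lemma orthonormal_basis_separates v : L2 Omega v ->
  (forall i (j : 'I_(mult i)), dotL2 Omega v (phi j) = 0) -> normL2 Omega v = 0.
Proof.
move=> Lv v0; have [_ [_ /(_ v Lv) H]] := phi_orthonormal.
have C : normL2 Omega (fun x => -1 * v x) @[_ --> \oo] --> (0 : R).
  apply: cvg_trans H; apply: near_eq_cvg; apply: nearW => N.
  congr (normL2 Omega _); apply/funext => x; rewrite mulN1r /= big1 ?sub0r//.
  by move=> k _; rewrite /eigenprojection big1// => j _; rewrite v0 mul0r.
rewrite -(normL2_const_cvg C) /normL2 /dotL2; congr Num.sqrt.
by apply: eq_Rintegral => x _; rewrite !mulN1r mulrNN.
Qed.

Context (O : normedModType R)
  (domC : set ('rV[R]_n -> R)) (C : ('rV[R]_n -> R) -> O).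
Hypothesis C_linear : observation_operator Omega domC C.

Let C_scale (c : R) u : domC u ->
  domC (fun x => c * u x) /\ C (fun x => c * u x) = c *: C u.
Proof.
have [_ d0 _ lin] := C_linear => du.
have C0 : C (cst 0) = 0.
  have [_] := lin 1 _ _ d0 d0.
  have -> : (fun x => 1 * cst 0 x + cst 0 x) = cst (0 : R) :> ('rV[R]_n -> R).
    by apply/funext => x; rewrite mulr0 addr0.
  by rewrite scale1r => /eqP; rewrite -subr_eq0 opprD addNKr oppr_eq0 => /eqP.
have := lin c _ _ du d0; rewrite C0 addr0.
by rewrite (_ : (fun x => c * u x + cst 0 x) = fun x => c * u x)//;
  apply/funext => x; rewrite addr0.
Qed.

(** The observation map only provides that E(t) phi is in the domain of C for
    almost every t, with E(t) = E_alpha (- lam t^alpha). Since E(t) tends to 1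
    at 0, some of these t have E(t) != 0, and phi itself is in the domain. *)
Lemma observation_eigenfunction (alpha T : R) i (j : 'I_(mult i)) (w : R -> O) :
  0 < T -> 0 < alpha -> 0 < lam i ->
  observation_map Omega domC C lam phi alpha T (phi j) w ->
  domC (phi j) /\ {ae @lebesgue_measure R, forall t, `]0, T[%classic t ->
    w t = mittag_leffler alpha (- lam i * t `^ alpha) *: C (phi j)}.
Proof.
move=> T0 a0 l0 [_ _ aw].
pose E t := mittag_leffler alpha (- lam i * t `^ alpha).
have {}aw : {ae @lebesgue_measure R, forall t, `]0, T[%classic t ->
    domC (fun x => E t * phi j x) /\ C (fun x => E t * phi j x) = w t}.
  move: aw; apply: filterS; first exact: (ae_filter_ringOfSetsType lebesgue_measure).
  move=> t H tT; have [u Su [du <-]] := H tT.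
  have [_ _ resp _] := C_linear.
  apply: resp => //; first exact: L2Z.
  move: (opS_eigenfunction Su); apply: filterS => x Hx Ox.
  by rewrite Hx.
have [K K0 KE] := @mittag_leffler_near0 R alpha a0.
(* |E t - 1| <= K |lam t^alpha| < 1 as soon as lam t^alpha <= B, that is t <= d *)
pose B := (K + 1)^-1 / 2.
have K1 : 0 < K + 1 by rewrite ltr_wpDl.
have B0 : 0 < B by rewrite divr_gt0 ?invr_gt0.
have B1 : B <= 1.
  rewrite /B -invfM invf_le1 ?mulr_gt0//; lra.
have KB : K * B < 1.
  rewrite /B -invfM ltr_pdivrMr ?mulr_gt0//; lra.
pose d := (B / lam i) `^ alpha^-1.
have d0 : 0 < d := powR_gt0 _ (divr_gt0 B0 l0).
have [t [t0 td [dE _]]] := ae_itv_witness T0 d0 aw.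
have Et : E t != 0.
  have tB : `|- lam i * t `^ alpha| <= B.
    rewrite normrM normrN (gtr0_norm l0) (ger0_norm (powR_ge0 _ _)) mulrC -ler_pdivlMr//.
    have -> : B / lam i = d `^ alpha.
      by rewrite /d -powRrM mulVf ?gt_eqF// powRr1// divr_ge0// ltW.
    by apply: ge0_ler_powR; rewrite ?nnegrE ?ltW.
  apply/eqP => E0; have := KE _ (le_trans tB B1).
  rewrite -/(E t) E0 sub0r normrN normr1 leNgt => /negP; apply.
  by apply: le_lt_trans KB; exact: ler_wpM2l.
have dphi : domC (phi j).
  have [] := C_scale (E t)^-1 dE.
  by rewrite (_ : (fun x => _) = phi j)//; apply/funext => x; rewrite mulKf.
split => //.
move: aw; apply: filterS; first exact: (ae_filter_ringOfSetsType lebesgue_measure).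
by move=> s H sT; have [_ <-] := H sT; have [_] := C_scale (E s) dphi.
Qed.

End eigenfunctions.

(** * The adjoint problem tested against an eigenfunction *)

Section tested_adjoint_problem.
Context (R : realType) (n : nat) (Omega : set 'rV[R]_n) (mO : measurable Omega).
Context (T alpha : R) (a : 'I_n -> 'I_n -> 'rV[R]_n -> R)
  (O : normedModType R) (dot : O -> O -> R)
  (domC : set ('rV[R]_n -> R)) (C : ('rV[R]_n -> R) -> O)
  (z : R -> O) (r : R -> 'rV[R]_n -> R).
Hypotheses (T_gt0 : 0 < T) (alpha_gt0 : 0 < alpha) (alpha_le1 : alpha <= 1).
Hypothesis dotP : hilbert_product dot.
Hypothesis zL2 : L2T T z.
Hypothesis sol : adjoint_solution Omega T alpha a dot domC C z r.
Variables (lambda : R) (p : 'rV[R]_n -> R).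
Hypothesis lambda_ge0 : 0 <= lambda.
Hypothesis Lp : L2 Omega p.
Hypothesis p_norm : normL2 Omega p = 1.
Hypothesis p_eigen : opA Omega a p (fun x => - lambda * p x).
Hypothesis domCp : domC p.

Notation mu := (@lebesgue_measure R).
Notation fk := (@frac_kernel R).
Local Notation w := (RL_integral T (1 - alpha) r).
Local Notation norm := (normL2 Omega).
Local Notation rho := (time_coef Omega T r p).

Let W s := dotL2 Omega (w s) p.
Let c : R -> R := (fun t => dot (C p) (z t)) \_ `]0, T[.
Let f t := c t - lambda * rho t.

Let c_in t : 0 < t < T -> c t = dot (C p) (z t).
Proof. by move=> tT; rewrite /c patchE mem_set//= in_itv. Qed.

Let c_out t : t <= 0 \/ T <= t -> c t = 0.
Proof.
move=> tT; rewrite /c patchE memNset//= in_itv/= => /andP[t0 t1].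
by case: tT; rewrite leNgt ?t0 ?t1.
Qed.

Let ic : mu.-integrable setT (EFin \o c).
Proof.
rewrite -restrict_EFin; apply/integrable_restrict => //=.
by rewrite setTI; exact: L2T_dot_integrable.
Qed.

Let irho : mu.-integrable setT (EFin \o rho).
Proof.
by apply: time_coef_integrable => //; [exact: sol_measurable sol|
  exact: sol_L2 sol|exact: sol_L1 sol].
Qed.

Let if_ : mu.-integrable setT (EFin \o f).
Proof.
have il := @integrableZl _ _ _ mu _ measurableT lambda _ irho.
by have := @integrableB _ _ _ mu _ measurableT _ _ ic il.
Qed.

Let f_out t : t <= 0 \/ T <= t -> f t = 0.
Proof. by move=> H; rewrite /f c_out// time_coef_out// mulr0 subrr. Qed.

Let Lw s : 0 <= s < T -> L2 Omega (w s).
Proof. by move=> /(sol_RL_integral sol)[]. Qed.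

Let W_norm u : L2 Omega u -> `|dotL2 Omega u p| <= norm u.
Proof. by move=> Lu; have := dotL2_cauchy_schwarz mO Lu Lp; rewrite p_norm mulr1. Qed.

Let W_sub_le s t : 0 <= s < T -> 0 <= t < T -> `|W t - W s| <= norm (w t \- w s).
Proof.
move=> sT tT; rewrite -dotL2Bl//; try exact: Lw.
by apply: W_norm; apply: L2B => //; exact: Lw.
Qed.

Let W_abs_cont s t : 0 < s -> t < T -> abs_cont W s t.
Proof.
move=> s0 tT e e0; have [d d0 H] := sol_abs_continuous sol s0 tT e0.
exists d => // N s' t' st dj S; apply: le_lt_trans (H N s' t' st dj S).
apply: ler_sum => i _; have [si sti ti] := st i; apply: W_sub_le.
  by rewrite (le_trans (ltW s0) si) (le_lt_trans (le_trans sti ti) tT).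
by rewrite (le_trans (ltW s0) (le_trans si sti)) (le_lt_trans ti tT).
Qed.

Let W_terminal : W s @[s --> T^'-] --> 0.
Proof.
apply: norm_cvg0; apply: (squeeze_cvgr _ _ (sol_terminal sol)); last exact: cvg_cst.
near=> s; rewrite normr_ge0/=; apply: W_norm; apply: Lw.
by apply/andP; split => //; near: s; exact: nbhs_left_ge.
Unshelve. all: by end_near. Qed.

Let W_initial : W s @[s --> 0^'+] --> W 0.
Proof.
apply/subr_cvg0; apply: norm_cvg0.
apply: (squeeze_cvgr _ _ (sol_continuous0 sol)); last exact: cvg_cst.
near=> s; rewrite normr_ge0/=; apply: W_sub_le; first by rewrite lexx T_gt0.
by apply/andP; split => //; near: s; exact: nbhs_right_lt.
Unshelve. all: by end_near. Qed.

(* the equation tested against p, which is in the domains of A and of C: the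
   adjoints are moved onto p *)
Let W_derivative : {ae mu, forall s, 0 < s < T ->
  h^-1 * (W (s + h) - W s) @[h --> 0^'] --> - f s}.
Proof.
move: (sol_L2 sol) (sol_equation sol); apply: filterS2.
  exact: (ae_filter_ringOfSetsType mu).
move=> s Ls Hs sT; have sT' : `]0, T[%classic s by rewrite /= in_itv.
have {}Ls := Ls sT'; have [Ar [Cz [[_ LA adA] [_ LC adC] [_ dw]]]] := Hs sT'.
have LAC : L2 Omega (Ar \+ Cz) by exact: L2D.
have Ef : f s = dotL2 Omega (Ar \+ Cz) p.
  have E1 := adA _ _ p_eigen; have E2 := adC p (C p) (conj domCp erefl).
  rewrite dotL2Dl// (dotL2C Omega Ar) (dotL2C Omega Cz) -E1 -E2 dotL2Zl//.
  by rewrite /f c_in// time_coefE// (dotL2C Omega p) mulNr addrC.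
apply/subr_cvg0; apply: norm_cvg0.
apply: (squeeze_cvgr _ _ dw); last exact: cvg_cst.
near=> h; rewrite normr_ge0/=.
have shT : 0 <= s + h < T.
  have hs : `|h| < Num.min s (T - s).
    near: h; apply: dnbhs0_lt; rewrite lt_min.
    by have /andP[-> ?] := sT; rewrite subr_gt0.
  move: hs; rewrite lt_min !ltr_norml => /andP[/andP[h1 _] /andP[_ h2]].
  by apply/andP; split; [apply: ltW; lra|lra].
have sT0 : 0 <= s < T by have /andP[/ltW -> ->] := sT.
have LB := L2B mO (Lw shT) (Lw sT0).
have -> : h^-1 * (W (s + h) - W s) - - f s =
    dotL2 Omega (fun y => h^-1 * (w (s + h) y - w s y) + (Ar \+ Cz) y) p.
  rewrite (dotL2Dl mO (L2Z mO _ LB) LAC Lp) (dotL2Zl mO _ LB Lp).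
  by rewrite (dotL2Bl mO (Lw shT) (Lw sT0) Lp) -Ef opprK.
apply: (le_trans (W_norm _)); first by apply: L2D => //; exact: L2Z.
rewrite le_eqVlt; apply/orP; left; apply/eqP; congr normL2.
by apply/funext => y; rewrite opprK.
Unshelve. all: by end_near. Qed.

Let W_fractional : alpha != 1 -> {ae mu, forall s, 0 < s < T ->
  W s = \int[mu]_e (fk (1 - alpha) (e - s) * rho e)}.
Proof.
move=> a1; apply: time_coef_RL_integral => //.
- exact: sol_measurable sol.
- exact: sol_L2 sol.
- exact: sol_L1 sol.
- by rewrite subr_gt0 lt_neqAle a1.
- by move=> s /andP[s0 sT]; apply: (sol_RL_integral sol); rewrite (ltW s0).
Qed.

Let integral_kernel_out b (h : R -> R) s :
  (forall t, t <= 0 \/ T <= t -> h t = 0) -> T <= s ->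
  \int[mu]_e (fk b (e - s) * h e) = 0.
Proof.
move=> h0 Ts; rewrite (_ : \int[mu]_e _ = \int[mu]_e (cst 0 e)).
  by rewrite Rintegral_cst// mul0r.
apply: eq_Rintegral => e _; have [eT|eT] := leP T e.
  by rewrite h0 ?mulr0//; right.
by rewrite frac_kernel_eq0 ?mul0r// subr_le0 (le_trans (ltW eT)).
Qed.

(** W(s) = int_s^T f by the fundamental theorem of calculus and
    W = I^(1-alpha) rho by Fubini; these are the two members of the balance
    required by the scalar duality. *)
Lemma tested_initial_value :
  dotL2 Omega (w 0) p =
  \int[mu]_(t in `]0, T[) (mittag_leffler alpha (- lambda * t `^ alpha) * dot (C p) (z t)).
Proof.
have WE := abs_cont_primitiveE T_gt0 if_ f_out W_abs_cont W_derivative W_terminal.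
have W0 : W 0 = \int[mu]_t f t :=
  abs_cont_initial_value T_gt0 if_ f_out W_abs_cont W_derivative W_terminal W_initial.
rewrite -/(W 0) W0 -(@mittag_leffler_duality R alpha lambda T rho c)//.
- rewrite [RHS]Rintegral_mkcond; apply: eq_Rintegral => t _.
  by rewrite /c !patchE; case: ifP => // _; rewrite mulr0.
- by move=> t; exact: time_coef_out.
have [a1|a1] := eqVneq alpha 1.
  apply: aeW => s s0; have [sT|sT] := ltP s T; last first.
    by rewrite integral_kernel_out// time_coef_out//; right.
  rewrite -WE ?s0// time_coefE ?s0// /W; congr dotL2.
  by apply/funext => y; rewrite /RL_integral a1 subrr eqxx.
move: (W_fractional a1); apply: filterS; first exact: (ae_filter_ringOfSetsType mu).
move=> s Ws s0; have [sT|sT] := ltP s T; last first.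
  by rewrite !integral_kernel_out//; exact: time_coef_out.
by rewrite -WE ?s0// Ws ?s0.
Qed.

End tested_adjoint_problem.

Theorem lemma13 (R : realType) (n : nat) (Omega : set 'rV[R]_n.+1)
    (Omega_open : open Omega) (Omega_bounded : bounded_set Omega)
    (Omega_connected : connected Omega)
    (Omega_lipschitz : lipschitz_boundary Omega)
    (T alpha : R) (T_gt0 : 0 < T) (alpha_gt0 : 0 < alpha) (alpha_le1 : alpha <= 1)
    (a : 'I_n.+1 -> 'I_n.+1 -> 'rV[R]_n.+1 -> R)
    (a_elliptic : elliptic_coefficients Omega a)
    (lam : nat -> R) (mult : nat -> nat)
    (phi : forall i : nat, 'I_(mult i) -> 'rV[R]_n.+1 -> R)
    (phi_basis : eigenbasis Omega lam phi a)
    (O : completeNormedModType R) (dot : O -> O -> R)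
    (dot_hilbert : hilbert_product dot)
    (domC : set ('rV[R]_n.+1 -> R)) (C : ('rV[R]_n.+1 -> R) -> O)
    (C_linear : observation_operator Omega domC C)
    (C_admissible : admissible Omega domC C lam phi alpha T)
    (domK : set ('rV[R]_n.+1 -> R))
    (domK_P : observability_domain Omega domC C lam phi alpha T domK)
    (z : R -> O) (Kz : 'rV[R]_n.+1 -> R)
    (z_Kz : adjK Omega dot domC C lam phi alpha T domK z Kz)
    (r : R -> 'rV[R]_n.+1 -> R)
    (r_solution : adjoint_solution Omega T alpha a dot domC C z r) :
  eqL2 Omega Kz (RL_integral T (1 - alpha) r 0).
Proof.
have mO := open_measurable_rV Omega_open.
have [lam0 lamS _ _ [phi_eigen phi_on]] := phi_basis.
have lam_gt0 i : 0 < lam i by elim: i => // i IH; exact: lt_trans (lamS i).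
have [zL2 LKz adj] := z_Kz; have [domA_K K_map] := domK_P.
have Lw0 : L2 Omega (RL_integral T (1 - alpha) r 0).
  by have [] := sol_RL_integral r_solution (_ : 0 <= 0 < T); rewrite ?lexx.
apply: eqL2_norm => //; apply: (orthonormal_basis_separates phi_on).
  exact: L2B.
move=> i j; have Lp : L2 Omega (phi i j) by case: phi_on => + _; apply.
have np : normL2 Omega (phi i j) = 1.
  by rewrite /normL2; case: phi_on => _ [-> _]; rewrite !eqxx sqrtr1.
rewrite dotL2Bl//; apply/eqP; rewrite subr_eq0; apply/eqP.
have Kp : domK (phi i j) by apply: domA_K; case: (phi_eigen i j).
have [w Hw] := K_map _ Kp.
have [domCp wE] := observation_eigenfunction mO phi_on C_linear T_gt0 alpha_gt0 (lam_gt0 i) Hw.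
rewrite dotL2C -(adj _ _ (conj Kp Hw)).
rewrite (tested_initial_value mO T_gt0 alpha_gt0 alpha_le1 dot_hilbert zL2 r_solution
  (ltW (lam_gt0 i)) Lp np (phi_eigen i j) domCp).
have [_ wL2 _] := Hw.
rewrite /dotL2T; congr fine.
have [swm _] := wL2; have [szm _] := zL2.
apply: ae_eq_integral => //.
- by apply/measurable_EFinP; exact: strongly_measurable_dot.
- apply/measurable_EFinP; apply: measurable_funM.
    exact: measurable_mittag_leffler.
  by apply: strongly_measurable_dot => //; exact: strongly_measurable_cst.
move: wE; apply: filterS; first exact: (ae_filter_ringOfSetsType lebesgue_measure).
by move=> t wt tT; rewrite wt// (hilbert_dotZl dot_hilbert).
Qed.
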